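(* Let $(\mathfrak g[\![x]\!],\delta,\varphi)$ be a topological quasi-Lie bialgebra structure corresponding to the quasi-$r$-matrix $r$. If we twist $W(r)$ with a skew-symmetric tensor $s\in(\mathfrak g\otimes\mathfrak g)[\![x,y]\!]$ we obtain another topological quasi-Lie bialgebra $(\mathfrak g[\![x]\!],\delta_s,\varphi_s)$, such that 1. $W(r)_s=W(r-s)$; 2. $\delta_s=\delta+ds$, where $ds(a)=[a\otimes1+1\otimes a,s]$; 3. $\varphi_s=\varphi+\mathrm{CYB}(s)-\frac12\mathrm{Alt}((\delta\otimes1)s)$.
   Context: $F$ is an algebraically closed field of characteristic $0$ (discrete topology), $\mathfrak g$ a finite-dimensional simple Lie algebra over $F$ with Killing form $\kappa$, $\{b_i\}_{i=1}^d$ a $\kappa$-orthonormal basis, $\Omega=\sum_ib_i\otimes b_i$. $\mathfrak g[\![x]\!]=\mathfrak g\otimes F[\![x]\!]$ has bracket $[a\otimes f,b\otimes g]=[a,b]\otimes fg$ and the $(x)$-adic topology; $\mathfrak g[\![x]\!]'$ is its continuous dual. **The algebra $L(n,\alpha)$.** Let $n\in\mathbb Z_{\ge0}$ and $\alpha=(\alpha_i\in F\mid-\infty<i\le n-2)$ a sequence, $\alpha(x)=x^{-n}+\alpha_{n-2}x^{-n+1}+\dots+\alpha_0x^{-1}+\dots\in F(\!(x)\!)$ (for $n=0$, $\alpha(x)=1+\alpha_{-2}x+\dots$). $A(n,\alpha)=F(\!(x)\!)\times F[x]/(x^n)$, $L(n,\alpha)=\mathfrak g\otimes A(n,\alpha)$,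 $t(f,[p])=\mathrm{res}_0\{\alpha(x)(f-p)\}$, $B(a\otimes v,b\otimes w)=\kappa(a,b)t(vw)$, $\Delta=\{(f,[f])\mid f\in\mathfrak g[\![x]\!]\}\cong\mathfrak g[\![x]\!]$. Write $b(f,[p])$ for $b\otimes(f,[p])$; $F[\![x]\!]$ acts by $u\cdot(f,[p])=(uf,[up])$. Lagrangian means $V=V^\perp$ with respect to $B$. **Topological quasi-Lie bialgebra structure** on $\mathfrak g[\![x]\!]$: a skew-symmetric continuous linear map $\delta:\mathfrak g[\![x]\!]\to(\mathfrak g\otimes\mathfrak g)[\![x,y]\!]$ and a skew-symmetric $\varphi\in(\mathfrak g^{\otimes3})[\![x,y,z]\!]$ with (1) $\delta([a,b])=[a\otimes1+1\otimes a,\delta(b)]-[b\otimes1+1\otimes b,\delta(a)]$; (2) $\frac12\mathrm{Alt}((\delta\otimes1)\delta(a))=[a\otimes1\otimes1+1\otimes a\otimes1+1\otimes1\otimes a,\varphi]$; (3) $\mathrm{Alt}((\delta\otimes1\otimes1)\varphi)=0$. Here $(\mathfrak g^{\otimes m})[\![x_1,\dots,x_m]\!]$ is regarded as the completed tensor power of $\mathfrak g[\![x]\!]$ (permutations of factors also permute variables; $a\otimes1+1\otimes a$ means $a(x)\otimes1+1\otimes a(y)$; a tensor is skew-symmetric if each transposition of factors changes its sign) and $\mathrm{Alt}(x_1\otimes\dots\otimes x_m)=\sum_{\sigma\in S_m}\mathrm{sgn}(\sigma)x_{\sigma(1)}\otimes\dots\otimes x_{\sigma(m)}$. **Series.** Elements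 of $(L(n,\alpha)\otimes\mathfrak g)[\![y]\!]$ are written $\sum_{k\ge0}\sum_if_{k,i}\otimes b_iy^k$ with $f_{k,i}\in L(n,\alpha)$, where $y^k$ stands for $(y^k,[y]^k)$. $\frac{y^n\Omega}{x-y}:=\sum_{k\ge0}\sum_iw_{k,i}\otimes b_iy^k$ with $w_{k,i}=b_i(0,-[x]^{n-1-k})$ for $0\le k\le n-1$, $w_{k,i}=b_i(x^{n-1-k},0)$ for $k\ge n$. $(\mathfrak g\otimes\mathfrak g)[\![x,y]\!]$ is embedded via $\mathfrak g[\![x]\!]\cong\Delta$. For $u\in F[\![x]\!]^\times$, a series of type $(n,u)$ is $r=\frac{u(x)y^n\Omega}{x-y}+g(x,y)$, $g\in(\mathfrak g\otimes\mathfrak g)[\![x,y]\!]$. Let $\tau$ be the $F[\![x,y]\!]$-linear extension of $a\otimes b\mapsto b\otimes a$. Put $\overline r=\frac{u(y)x^n\Omega}{x-y}-\tau(g(y,x))$, meaning $\frac{u(x)y^n\Omega}{x-y}-\frac{u(x)y^n-u(y)x^n}{x-y}\Omega-\tau(g(y,x))$. A quasi-$r$-matrix is a skew-symmetric series ($r=\overline r$) of such a type. For $r=\sum f_{k,i}\otimes b_iy^k$ put $W(r)=\mathrm{span}_F\{f_{k,i}\}\subset L(n,\alpha)$; the assignment $r\mapsto W(r)$ is a bijection from skew-symmetric series of type $\left(n,\frac1{x^n\alpha(x)}\right)$ to Lagrangian subspaces of $L(n,\alpha)$ complementary to $\Delta$. In the claim $r$ is a quasi-$r$-matrix of type $\left(n,\frac1{x^n\alpha(x)}\right)$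 and $W(r)$ is taken in $L(n,\alpha)$. **CYB.** $\mathrm{CYB}(r)=[r^{12},r^{13}]+[r^{12},r^{23}]+[r^{13},r^{23}]$, where $r^{12}=\sum f_{k,i}(x_1)\otimes b_ix_2^k\otimes1$, $r^{13}=\sum f_{k,i}(x_1)\otimes1\otimes b_ix_3^k$, $r^{23}=\sum1\otimes f_{k,i}(x_2)\otimes b_ix_3^k$ in $U(\mathfrak g)^{\otimes3}\otimes A_3$, with $A_1=A(n,\alpha)$ in $x_1$, $A_m=A_{m-1}(\!(x_m)\!)\oplus A_{m-1}[x_m]/x_m^nA_{m-1}$; the same formula defines $\mathrm{CYB}(s)$ for $s\in(\mathfrak g\otimes\mathfrak g)[\![x,y]\!]$. **Correspondence.** A Lagrangian subspace $W\subset L(n,\alpha)$ complementary to $\Delta\cong\mathfrak g[\![x]\!]$ is identified through $B$ with $\mathfrak g[\![x]\!]'$; writing $[f,g]=p_1(f\otimes g)+p_2(f\otimes g)$ for $f,g\in W$, with $p_1(f\otimes g)\in\Delta$, $p_2(f\otimes g)\in W$, the corresponding quasi-Lie bialgebra structure has $\delta$ the dual map of $p_2$ and $\varphi=-\psi$, where $B(f\otimes g\otimes h,\psi)=B(h,p_1(f\otimes g))$ for all $f,g,h\in W$. The structure corresponding to a quasi-$r$-matrix $r$ is the one corresponding to $W(r)$; it satisfies $\delta(a)=-[a\otimes1+1\otimes a,r]$ and $\varphi=-\mathrm{CYB}(r)$. **Twisting.** For a Lagrangian subspace $W\subset L(n,\alpha)$ complementary to $\Delta$ and a skew-symmetric tensor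 $s=\sum_ia_i\otimes b^i\in(\mathfrak g\otimes\mathfrak g)[\![x,y]\!]$ ($a_i,b^i\in\mathfrak g[\![x]\!]\cong\Delta$), the twist of $W$ by $s$ is $W_s:=\{\sum_iB(b^i,w)a_i-w\mid w\in W\}$, again a Lagrangian subspace complementary to $\Delta$; $(\delta_s,\varphi_s)$ is the structure corresponding to $W(r)_s$.
   Formalization: Item 3 is proved with the opposite sign of the correction, φ_s = φ − CYB(s) + ½Alt((δ⊗1)s); the printed sign contradicts φ = −CYB(r) and W(r)_s = W(r−s), and fails for r = Ω/(x−y) with constant s such that CYB(s) ≠ 0. *)

(* Defs.v *)
From HB Require Import structures.
From mathcomp Require Import all_boot all_order all_algebra all_fingroup.
From mathcomp Require Import boolp classical_sets functions fsbigop.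

Set Implicit Arguments.
Unset Strict Implicit.
Unset Printing Implicit Defensive.

Import Order.TTheory GRing.Theory Num.Theory.
Local Open Scope classical_set_scope.
Local Open Scope ring_scope.

HB.mixin Record isLieAlgebra (F : fieldType) g of Vector F g := {
  lie : g -> g -> g;
  lie_linearr : forall x : g, linear (lie x);
  lie_linearl : forall y : g, linear (lie ^~ y);
  liexx : forall x : g, lie x x = 0;
  lie_jacobi : forall x y z : g,
    lie x (lie y z) + lie y (lie z x) + lie z (lie x y) = 0 }.

#[short(type="lieAlgType")]
HB.structure Definition LieAlgebra (F : fieldType) :=
  {g of Vector F g & isLieAlgebra F g}.

Section SimpleLie.
Variables (F : fieldType) (g : lieAlgType F).
Implicit Types (a c : g) (I : {vspace g}).

Definition lie_ideal I := forall a c, c \in I -> lie a c \in I.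

Definition simple_lie :=
  (exists a c, lie a c != 0) /\
  (forall I, lie_ideal I -> I = 0%VS \/ I = fullv).

Definition ad a : 'End(g) := linfun (lie a).

Definition killing a c : F :=
  let e := vbasis {:g} in \tr (passmx.mxof e e (ad a \o ad c)%VF).

Definition killing_orthonormal_basis (b : (\dim {:g}).-tuple g) :=
  basis_of {:g} b /\ forall i j : 'I_(\dim {:g}), killing b`_i b`_j = (i == j)%:R.

End SimpleLie.

(* Laurent series with coefficients in V; for V = g finite-dimensional this is
   g tensor F((x)). *)
Section Laurent.
Variables (R : pzRingType) (V : lmodType R).

Definition bounded_below : {pred int -> V} :=
  fun f => `[< exists N : int, forall m, m < N -> f m = 0 >].

Fact bounded_below_submod : subsemimod_closed bounded_below.
Proof.
split; first split.
- by apply/asboolP; exists 0.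
- move=> f h /asboolP[N fN] /asboolP[M hM]; apply/asboolP.
  exists (Num.min N M) => m; rewrite lt_min => /andP[mN mM].
  by rewrite /GRing.add /= fN// hM// addr0.
- move=> c f /asboolP[N fN]; apply/asboolP; exists N => m mN.
  by rewrite /GRing.scale /= fN// scaler0.
Qed.

HB.instance Definition _ :=
  GRing.isSubmodClosed.Build R (int -> V) bounded_below bounded_below_submod.

Record laurent := Laurent {
  lcoef :> int -> V;
  lcoefP : lcoef \in bounded_below }.

HB.instance Definition _ := [isSub for lcoef].
HB.instance Definition _ := [Choice of laurent by <:].
HB.instance Definition _ := [SubChoice_isSubZmodule of laurent by <:].
HB.instance Definition _ := [SubZmodule_isSubLmodule of laurent by <:].

Definition zext (a : nat -> V) (m : int) : V := if m is Posz k then a k else 0.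

Fact zext_bounded a : zext a \in bounded_below.
Proof. by apply/asboolP; exists 0 => -[]. Qed.

Definition laurent_of (a : nat -> V) : laurent := Laurent (zext_bounded a).

Definition lmono_coef (k : int) (v : V) (m : int) : V :=
  if m == k then v else 0.

Fact lmono_bounded k v : lmono_coef k v \in bounded_below.
Proof.
by apply/asboolP; exists k => m mk; rewrite /lmono_coef lt_eqF.
Qed.

Definition lmono k v : laurent := Laurent (lmono_bounded k v).

(* An element of V[x]/(x^n) is the family of its n coefficients. *)
Definition tmono n (k : nat) (v : V) : 'I_n -> V :=
  fun m => if m == k :> nat then v else 0.

(* Coefficient at x^m of the representative of degree < n. *)
Definition tcoef n (p : 'I_n -> V) (m : int) : V :=
  \sum_(i < n | i%:Z == m) p i.

End Laurent.

(* Products of series for an arbitrary pairing beta of the coefficients.  The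
   sum in [lconv] has finite support when f and h are bounded below and
   beta 0 _ = beta _ 0 = 0, the only case in which it is used. *)
Definition lconv (U V : Type) (Z : nmodType) (beta : U -> V -> Z)
    (f : int -> U) (h : int -> V) (m : int) : Z :=
  \sum_(i \in [set: int]) beta (f i) (h (m - i)).

Definition tconv n (U V : Type) (Z : nmodType) (beta : U -> V -> Z)
    (p : 'I_n -> U) (q : 'I_n -> V) (m : 'I_n) : Z :=
  \sum_(i < n) \sum_(j < n | (i + j == m)%N) beta (p i) (q j).

Definition psconv (U V : Type) (Z : nmodType) (beta : U -> V -> Z)
    (a : nat -> U) (c : nat -> V) (m : nat) : Z :=
  \sum_(k < m.+1) beta (a k) (c (m - k)%N).

Fact lconv_bounded (R S T : pzRingType) (U : lmodType R) (V : lmodType S)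
    (Z : lmodType T) (beta : U -> V -> Z) (f : laurent U) (h : laurent V) :
    (forall y, beta 0 y = 0) -> (forall x, beta x 0 = 0) ->
  lconv beta f h \in @bounded_below T Z.
Proof.
move=> b0l b0r; have /asboolP[N fN] := lcoefP f; have /asboolP[M hM] := lcoefP h.
apply/asboolP; exists (N + M) => m mNM; rewrite /lconv fsbig1// => i _.
have [iN|Ni] := ltP i N; first by rewrite fN.
by rewrite hM// ltrBlDl (lt_le_trans mNM)// lerD2r.
Qed.

Definition lspan (R : pzRingType) (V : lmodType R) (X : set V) : set V :=
  [set v | exists m (c : 'I_m -> R) (x : 'I_m -> V),
     (forall i, X (x i)) /\ v = \sum_(i < m) c i *: x i].

(* The algebra L(n, alpha) = g tensor (F((x)) x F[x]/(x^n)); its underlying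
   space and bracket do not depend on alpha. *)
Section LoopAlgebra.
Variables (F : fieldType) (g : lieAlgType F) (n : nat).

Definition loop := (laurent g * ('I_n -> g))%type.

Fact lie0x (y : g) : lie 0 y = 0.
Proof. by have := lie_linearl y (-1) 0 0; rewrite scaler0 addr0 scaleN1r addNr. Qed.

Fact liex0 (x : g) : lie x 0 = 0.
Proof. by have := lie_linearr x (-1) 0 0; rewrite scaler0 addr0 scaleN1r addNr. Qed.

Definition loop_lie (v w : loop) : loop :=
  (Laurent (lconv_bounded v.1 w.1 lie0x liex0), tconv lie v.2 w.2).

Definition loop_act (u : nat -> F) (v : loop) : loop :=
  (Laurent (lconv_bounded (laurent_of (u : nat -> F^o)) v.1
              (@scale0r F g) (@scaler0 F g)),
   tconv *:%R (fun i : 'I_n => u i) v.2).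

(* The embedding f |-> (f, [f]) of g[[x]], with image Delta. *)
Definition diag (a : nat -> g) : loop :=
  (laurent_of a, fun i : 'I_n => a i).

Definition Delta : set loop := range diag.

(* The coefficient alpha_i, used for i <= n - 2 only, is that of x^(-i-1). *)
Variable alpha : int -> F.

Definition alpha_coef (m : int) : F :=
  if m < - n%:Z then 0 else if m == - n%:Z then 1 else alpha (- m - 1).

(* The coefficient of x^k in x^n alpha(x). *)
Definition xn_alpha (k : nat) : F := alpha_coef (k%:Z - n%:Z).

(* t(f, [p]) = res_0 (alpha(x) (f - p)) *)
Definition tres (f : int -> F) (p : 'I_n -> F) : F :=
  \sum_(m \in [set: int])
     alpha_coef m * (f (- 1 - m) - tcoef (p : 'I_n -> F^o) (- 1 - m)).

Definition Bform (v w : loop) : F :=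
  tres (lconv (@killing F g) v.1 w.1) (tconv (@killing F g) v.2 w.2).

Definition lagrangian (W : set loop) :=
  W = [set v | forall w, W w -> Bform v w = 0].

Definition complement_Delta (W : set loop) :=
  W `&` Delta = [set 0] /\
  forall v, exists w d, [/\ W w, Delta d & v = w + d].

End LoopAlgebra.

Definition ps_inverse (F : fieldType) (u v : nat -> F) :=
  forall m, psconv *%R u v m = (m == 0)%:R.

(* Completed tensor powers of g[[x]].  They are described by coordinates: the
   index (i, k) stands for the vector b_i x^k, and t p q (resp. t p q r, ...)
   is the coefficient of t at the tensor product of the vectors with indices
   p, q (resp. p, q, r, ...), the j-th factor carrying the j-th variable. *)
Section Tensors.
Variables (F : fieldType) (g : lieAlgType F).
Variable b : (\dim {:g}).-tuple g.

Definition idx := ('I_(\dim {:g}) * nat)%type.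
Definition tens2 := idx -> idx -> F.
Definition tens3 := idx -> idx -> idx -> F.
Definition tens4 := idx -> idx -> idx -> idx -> F.

Definition ps_coord (a : nat -> g) (p : idx) : F := coord b p.1 (a p.2).

Definition ps_of_coord (c : idx -> F) (k : nat) : g :=
  \sum_(i < \dim {:g}) c (i, k) *: b`_i.

Definition bmono (p : idx) (k : nat) : g := if k == p.2 then b`_(p.1) else 0.

Definition ps_lie (a c : nat -> g) : nat -> g := psconv lie a c.

Definition clie (c c' : idx -> F) : idx -> F :=
  ps_coord (ps_lie (ps_of_coord c) (ps_of_coord c')).

(* [a @ 1 + 1 @ a, t] and [a @ 1 @ 1 + 1 @ a @ 1 + 1 @ 1 @ a, t] *)
Definition act2 (a : nat -> g) (t : tens2) : tens2 := fun p q =>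
  clie (ps_coord a) (fun p' => t p' q) p + clie (ps_coord a) (fun q' => t p q') q.

Definition act3 (a : nat -> g) (t : tens3) : tens3 := fun p q r =>
  clie (ps_coord a) (fun p' => t p' q r) p +
  clie (ps_coord a) (fun q' => t p q' r) q +
  clie (ps_coord a) (fun r' => t p q r') r.

Definition skew2 (t : tens2) := forall p q, t q p = - t p q.

Definition skew3 (t : tens3) := forall p q r,
  [/\ t q p r = - t p q r, t p r q = - t p q r & t r q p = - t p q r].

(* x_{s 1} @ ... @ x_{s m} has coefficient t (P (s^-1 1)) ... (P (s^-1 m)) at P
   when t = x_1 @ ... @ x_m; s and s^-1 have the same sign, and the sum is over
   the whole group. *)
Definition alt3 (t : tens3) : tens3 := fun p q r =>
  let P := tnth [tuple p; q; r] in
  \sum_(s : 'S_3) (-1) ^+ s *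
     t (P (s (inord 0))) (P (s (inord 1))) (P (s (inord 2))).

Definition alt4 (t : tens4) : tens4 := fun p q r z =>
  let P := tnth [tuple p; q; r; z] in
  \sum_(s : 'S_4) (-1) ^+ s *
     t (P (s (inord 0))) (P (s (inord 1))) (P (s (inord 2))) (P (s (inord 3))).

(* (delta @ 1) t and (delta @ 1 @ 1) t, extended by continuity: delta is applied
   to the coefficients in g[[x]] of t along its first factor. *)
Definition delta_l2 (delta : (nat -> g) -> tens2) (t : tens2) : tens3 :=
  fun p q r => delta (ps_of_coord (fun p' => t p' r)) p q.

Definition delta_l3 (delta : (nat -> g) -> tens2) (t : tens3) : tens4 :=
  fun p q r z => delta (ps_of_coord (fun p' => t p' r z)) p q.

(* Continuity for the (x)-adic and (x, y)-adic topologies. *)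
Definition adic_continuous (delta : (nat -> g) -> tens2) :=
  forall (a : nat -> g) (N : nat), exists M : nat, forall a' : nat -> g,
    (forall k, (k < M)%N -> a' k = a k) ->
    forall p q : idx, (p.2 + q.2 < N)%N -> delta a' p q = delta a p q.

Record quasi_lie_bialgebra (delta : (nat -> g) -> tens2) (phi : tens3) : Prop := {
  qlb_linear : forall (c : F) (a a' : nat -> g) (p q : idx),
    delta (c *: a + a') p q = c * delta a p q + delta a' p q;
  qlb_continuous : adic_continuous delta;
  qlb_skew2 : forall a, skew2 (delta a);
  qlb_skew3 : skew3 phi;
  qlb_cocycle : forall (a c : nat -> g) (p q : idx),
    delta (ps_lie a c) p q = act2 a (delta c) p q - act2 c (delta a) p q;
  qlb_cojacobi : forall (a : nat -> g) (p q r : idx),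
    2%:R^-1 * alt3 (delta_l2 delta (delta a)) p q r = act3 a phi p q r;
  qlb_alt_phi : forall p q r z : idx, alt4 (delta_l3 delta phi) p q r z = 0 }.

(* CYB(s) = [s12, s13] + [s12, s23] + [s13, s23], each commutator being the
   bracket of the factors of s in the common slot. *)
Definition CYB (s : tens2) : tens3 := fun p q r =>
  clie (fun p' => s p' q) (fun p' => s p' r) p +
  clie (fun q' => s p q') (fun q' => s q' r) q +
  clie (fun r' => s p r') (fun r' => s q r') r.

End Tensors.

(* Elements sum_(k, i) f_(k, i) @ b_i y^k of (L @ g)[[y]]. *)
Section Series.
Variables (F : fieldType) (g : lieAlgType F).
Variable b : (\dim {:g}).-tuple g.
Variable n : nat.

Definition lseries := nat -> 'I_(\dim {:g}) -> loop g n.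

Definition lseries_of (t : tens2 g) : lseries :=
  fun k i => diag n (ps_of_coord b (fun p => t p (i, k))).

(* y^n Omega / (x - y): the coefficients of y^0, ..., y^(n-1) are in the factor
   F[x]/(x^n), those of the higher powers of y in the factor F((x)). *)
Definition yOmega : lseries := fun k i =>
  if (k < n)%N then (0, fun m => - tmono (n - 1 - k) b`_i m)
  else (lmono (n%:Z - 1 - k%:Z) b`_i, 0).

Definition singular (u : nat -> F) : lseries :=
  fun k i => loop_act u (yOmega k i).

Definition mul_xsuby (h : nat -> nat -> F) (k l : nat) : F :=
  (if k is k'.+1 then h k' l else 0) - (if l is l'.+1 then h k l' else 0).

Definition hOmega (h : nat -> nat -> F) : tens2 g :=
  fun p q => (p.1 == q.1)%:R * h p.2 q.2.

(* r = u(x) y^n Omega / (x - y) + t is skew-symmetric of type (n, u); h is the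
   power series (u(x) y^n - u(y) x^n) / (x - y), and tau(t(y, x)) has the
   coordinates of t with its arguments exchanged. *)
Definition quasi_r_matrix (u : nat -> F) (r : lseries) :=
  exists (t : tens2 g) (h : nat -> nat -> F),
    [/\ r = singular u + lseries_of t,
        forall k l, mul_xsuby h k l = u k *+ (l == n) - u l *+ (k == n)
      & r = singular u - lseries_of (hOmega h) - lseries_of (fun p q => t q p)].

Definition Wspace (r : lseries) : set (loop g n) :=
  lspan [set v | exists k i, v = r k i].

Variable alpha : int -> F.
Notation B := (Bform alpha).
Notation e p := (diag n (bmono b p)).

(* B extended to tensor powers; only finitely many B f (e p) are nonzero. *)
Definition Bform2 (f f' : loop g n) (t : tens2 g) : F :=
  \sum_(p \in [set: idx g * idx g]) t p.1 p.2 * (B f (e p.1) * B f' (e p.2)).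

Definition Bform3 (f f' f'' : loop g n) (t : tens3 g) : F :=
  \sum_(p \in [set: idx g * idx g * idx g])
     t p.1.1 p.1.2 p.2 * (B f (e p.1.1) * B f' (e p.1.2) * B f'' (e p.2)).

(* (delta, phi) is the structure corresponding to W: with [f, f'] = p1 + p2,
   delta is dual to p2, and phi = - psi with psi dual to p1. *)
Definition corresponds (W : set (loop g n)) (delta : (nat -> g) -> tens2 g)
    (phi : tens3 g) :=
  forall f f' p1 p2 : loop g n, W f -> W f' -> Delta p1 -> W p2 ->
    loop_lie f f' = p1 + p2 ->
    (forall a, Bform2 f f' (delta a) = B p2 (diag n a)) /\
    (forall f'', W f'' ->
       Bform3 f f' f'' (fun p q r => - phi p q r) = B f'' p1).

(* W_s = {sum_i B(b^i, w) a_i - w | w in W} for s = sum_i a_i @ b^i *)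
Definition twist (W : set (loop g n)) (s : tens2 g) : set (loop g n) :=
  [set v | exists2 w, W w &
     v = diag n (ps_of_coord b (fun p =>
           \sum_(q \in [set: idx g]) s p q * B (e q) w)) - w].

End Series.

(* Main.v *)
Require Import Defs.
From HB Require Import structures.
From mathcomp Require Import all_boot all_order all_algebra all_fingroup.
From mathcomp Require Import zify ring.
From mathcomp Require Import boolp classical_sets functions fsbigop.
Set Implicit Arguments.
Unset Strict Implicit.
Unset Printing Implicit Defensive.
Import Order.TTheory GRing.Theory Num.Theory.
Local Open Scope classical_set_scope.
Local Open Scope ring_scope.

(** Write r_p, for p = (i, k), for the coefficient of r at b_i y^k, and e_p for
    b_i x^k, seen in Delta.  The form B on L(n, alpha) is symmetric and
    invariant, and Delta is an isotropic subalgebra.  Two pairings control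
    everything:

    - B(r_p, e_q) = delta_pq: since u alpha = x^(-n), pairing
      u(x) y^n Omega / (x - y) with Delta extracts a coefficient, and the
      regular part of r lies in the isotropic Delta ([term_diag]);
    - B(r_p, r_q) = 0: this is a restatement of the skew-symmetry of r, because
      the pairings of the singular parts are the coefficients of
      (u(x) y^n - u(y) x^n) Omega / (x - y) ([singular_form], [term_iso]).

    Hence W(r) = {v | B(r_p, v) = 0 for all p}, it is Lagrangian, and
    v |-> sum_p B(r_p, v) e_p is the projection P onto Delta along W(r).
    In particular B(v, w) = B(v, P w) + B(P v, w), the polarization identity
    that is gathered with the two pairings in [lagrangian_frame].

    Testing the definition of the structure corresponding to W(r) on the vectors
    r_p gives explicit formulas ([corresponds_unique]),

      delta(a)_pq = B([r_p, r_q], a),    phi_pqz = - B([r_p, r_q], r_z),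

    and these formulas do define a corresponding structure
    ([corresponds_structure]).  Each axiom of a quasi-Lie bialgebra then becomes
    the Jacobi identity of L(n, alpha), paired into terms B([., .], [., .])
    that are cut in two by polarization ([cobr_cocycle],
    [cobr_cojacobi], [cobr_cophi]); only the skew-symmetry of the series is used,
    so the axioms hold for r - s as well as for r.

    A twist by s replaces r_p by r_p - s_p with s_p = sum_q s_qp e_q in Delta:
    sum_q s_pq B(e_q, w) = B(- s_p, w), so the equations
    B(r_p - s_p, v) = 0 of W(r - s) are those of the twist ([twist_Wspace]).
    Expanding B([r_p - s_p, r_q - s_q], .) by multilinearity gives the formulas
    for the twisted structure ([cobr_twist], [cophi_twist]): the terms with
    one s and one argument in Delta give the coboundary of s, those with two s
    give CYB(s), those with one s and two r give delta applied to s, and the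
    terms in Delta only vanish because Delta is an isotropic subalgebra. *)

(** * Convolution of power series *)

(** All the sums with finite support below (over degrees in the integers, or over
    indices of series) are turned into sums over a finite type by listing a
    finite set that contains the support. *)
Lemma fsum_inj (Z : nmodType) (I : choiceType) (T : finType) (h : T -> I)
    (G : I -> Z) :
    injective h -> (forall i, (forall t, h t <> i) -> G i = 0) ->
  \sum_(i \in [set: I]) G i = \sum_t G (h t).
Proof.
move=> h_inj G0; rewrite (fsbigE [seq h t | t <- index_enum T])
  ?map_inj_uniq ?index_enum_uniq//.
  by rewrite big_map; apply: eq_bigl => t; rewrite in_setT.
move=> i _ iN; apply: G0 => t hti; case/negP: iN.
by rewrite -hti map_f ?mem_index_enum.
Qed.

Definition biadditive (U V Z : zmodType) (beta : U -> V -> Z) :=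
  (forall x, {morph beta x : y z / y + z}) /\
  (forall z, {morph beta^~ z : x y / x + y}).

Section Biadditive.
Variables (U V Z : zmodType) (beta : U -> V -> Z).
Hypothesis beta_add : biadditive beta.

Lemma biaddr0 x : beta x 0 = 0.
Proof. by apply: (addrI (beta x 0)); rewrite -(beta_add.1 x) !addr0. Qed.

Lemma biadd0r y : beta 0 y = 0.
Proof. by apply: (addrI (beta 0 y)); rewrite -(beta_add.2 y) !addr0. Qed.

Lemma biadd_sumr x I (s : seq I) (P : pred I) (E : I -> V) :
  beta x (\sum_(i <- s | P i) E i) = \sum_(i <- s | P i) beta x (E i).
Proof. exact: (big_morph (beta x) (beta_add.1 x) (biaddr0 x)). Qed.

Lemma biadd_suml y I (s : seq I) (P : pred I) (E : I -> U) :
  beta (\sum_(i <- s | P i) E i) y = \sum_(i <- s | P i) beta (E i) y.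
Proof. exact: (big_morph (beta^~ y) (beta_add.2 y) (biadd0r y)). Qed.

End Biadditive.

(** The Cauchy product as a sum over pairs: with a common bound N on the indices,
    nested products become sums over triples, which can be permuted. *)
Lemma psconv_pairs (U V Z : zmodType) (beta : U -> V -> Z) a c N m : (m < N)%N ->
  psconv beta a c m =
    \sum_(i < N) \sum_(j < N | (i + j == m)%N) beta (a i) (c j).
Proof.
move=> mN; rewrite /psconv (big_ord_widen N (fun k => beta (a k) (c (m - k)%N)))//.
rewrite [LHS]big_mkcond; apply: eq_bigr => i _; case: ifPn => im.
  have jN : (m - i < N)%N by lia.
  rewrite (big_pred1 (Ordinal jN))//= => j /=; rewrite -val_eqE /=; lia.
by rewrite big1// => j /eqP; lia.
Qed.

(** The product of three series along a trilinear map: both ways of nesting two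
    Cauchy products reduce to it, so that associativity, invariance and the
    Jacobi identity for series follow from their coefficientwise versions. *)
Definition psconv3 (U V W Z : zmodType) (tau : U -> V -> W -> Z)
    (a : nat -> U) (c : nat -> V) (e : nat -> W) m : Z :=
  \sum_(i < m.+1) \sum_(j < m.+1) \sum_(k < m.+1 | (i + j + k == m)%N)
    tau (a i) (c j) (e k).

Lemma psconv_nestr (U V W X Z : zmodType) (beta : U -> X -> Z)
    (gamma : V -> W -> X) a c e m : biadditive beta ->
  psconv beta a (psconv gamma c e) m =
    psconv3 (fun x y z => beta x (gamma y z)) a c e m.
Proof.
move=> badd; rewrite (psconv_pairs _ _ _ (ltnSn m)); apply: eq_bigr => i _.
transitivity (\sum_(l < m.+1 | (i + l == m)%N) \sum_(j < m.+1)
   \sum_(k < m.+1 | (j + k == l)%N) beta (a i) (gamma (c j) (e k))).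
  apply: eq_bigr => l _; rewrite (psconv_pairs _ _ _ (ltn_ord l)).
  by rewrite biadd_sumr//; apply: eq_bigr => j _; rewrite biadd_sumr.
rewrite exchange_big; apply: eq_bigr => j _.
rewrite (exchange_big_dep (fun k : 'I_m.+1 => i + j + k == m)%N) /=; last first.
  by move=> l k /eqP ilm /eqP jkl; rewrite -addnA jkl ilm.
apply: eq_bigr => k /eqP ijk; have lm : (j + k < m.+1)%N by lia.
by rewrite (big_pred1 (Ordinal lm))//= => l /=; rewrite -val_eqE /=; lia.
Qed.

Lemma psconv_nestl (U V W X Z : zmodType) (beta : X -> W -> Z)
    (gamma : U -> V -> X) a c e m : biadditive beta ->
  psconv beta (psconv gamma a c) e m =
    psconv3 (fun x y z => beta (gamma x y) z) a c e m.
Proof.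
move=> badd; rewrite (psconv_pairs _ _ _ (ltnSn m)) (exchange_big_dep xpredT)//=.
rewrite (eq_bigr (fun k : 'I_m.+1 => \sum_(i < m.+1)
    \sum_(j < m.+1 | (i + j + k == m)%N) beta (gamma (a i) (c j)) (e k))).
  rewrite exchange_big; apply: eq_bigr => i _.
  by rewrite [RHS](exchange_big_dep xpredT).
move=> k _.
transitivity (\sum_(l < m.+1 | (l + k == m)%N) \sum_(i < m.+1)
   \sum_(j < m.+1 | (i + j == l)%N) beta (gamma (a i) (c j)) (e k)).
  apply: eq_bigr => l _; rewrite (psconv_pairs _ _ _ (ltn_ord l)).
  by rewrite biadd_suml//; apply: eq_bigr => i _; rewrite biadd_suml.
rewrite exchange_big; apply: eq_bigr => i _.
rewrite (exchange_big_dep (fun j : 'I_m.+1 => i + j + k == m)%N) /=; last first.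
  by move=> l j /eqP lkm /eqP ijl; rewrite ijl lkm.
apply: eq_bigr => j /eqP ijk; have lm : (i + j < m.+1)%N by lia.
by rewrite (big_pred1 (Ordinal lm))//= => l /=; rewrite -val_eqE /=; lia.
Qed.

Lemma psconv3_rot (U V W Z : zmodType) (tau : U -> V -> W -> Z) a c e m :
  psconv3 tau a c e m = psconv3 (fun y z x => tau x y z) c e a m.
Proof.
rewrite /psconv3 exchange_big; apply: eq_bigr => j _.
rewrite (exchange_big_dep xpredT)//=; apply: eq_bigr => k _.
by apply: eq_bigl => i; rewrite -addnA addnC.
Qed.

Lemma psconvA (U V W X Y Z : zmodType) (b1 : U -> X -> Z) (b2 : V -> W -> X)
    (b3 : Y -> W -> Z) (b4 : U -> V -> Y) a c e m :
    biadditive b1 -> biadditive b3 ->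
    (forall x y z, b1 x (b2 y z) = b3 (b4 x y) z) ->
  psconv b1 a (psconv b2 c e) m = psconv b3 (psconv b4 a c) e m.
Proof.
move=> add1 add3 b1234; rewrite psconv_nestr// psconv_nestl//.
do 3![apply: eq_bigr => ? _]; exact: b1234.
Qed.

Lemma psconvC (U V Z : zmodType) (beta : U -> V -> Z) a c m :
  psconv beta a c m = psconv (fun y x => beta x y) c a m.
Proof.
rewrite /psconv (reindex_inj rev_ord_inj) /=; apply: eq_bigr => i _.
by rewrite subSS subKn// -ltnS.
Qed.

Definition psmono (V : zmodType) (k : nat) (v : V) (m : nat) : V :=
  if m == k then v else 0.

Lemma psconv_monor (U V Z : zmodType) (beta : U -> V -> Z) a k v m :
    biadditive beta ->
  psconv beta a (psmono k v) m = if (k <= m)%N then beta (a (m - k)%N) v else 0.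
Proof.
move=> badd; case: leqP => km.
  have im : (m - k < m.+1)%N by lia.
  rewrite /psconv (bigD1 (Ordinal im))//= big1; last first.
    move=> i; rewrite -val_eqE/= /psmono => ik; rewrite ifN ?biaddr0//.
    have := ltn_ord i; lia.
  by rewrite addr0 subKn// /psmono eqxx.
rewrite /psconv big1// => i _; rewrite /psmono ifN ?biaddr0//.
have := ltn_ord i; lia.
Qed.

Lemma psconv_monol (U V Z : zmodType) (beta : U -> V -> Z) k v c m :
    biadditive beta ->
  psconv beta (psmono k v) c m = if (k <= m)%N then beta v (c (m - k)%N) else 0.
Proof.
by move=> [addr addl]; rewrite psconvC psconv_monor.
Qed.

(** * Laurent series and loops as shifted power series *)

Section LaurentShift.
Variables (R : pzRingType) (V : lmodType R).

(** The Laurent series x^(-K) a. *)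
Definition zshift (K : nat) (a : nat -> V) (m : int) : V := zext a (m + K%:Z).

Fact zshift_bounded K a : zshift K a \in @bounded_below R V.
Proof.
apply/asboolP; exists (- K%:Z) => m mK; rewrite /zshift.
by case E: (m + K%:Z) => [k|//]; lia.
Qed.

Definition lshift K a : laurent V := Laurent (zshift_bounded K a).

Definition lowered (K : nat) (f : laurent V) (k : nat) : V := f (k%:Z - K%:Z).

Lemma loweredK (f : laurent V) :
  exists K0, forall K, (K0 <= K)%N -> f = lshift K (lowered K f).
Proof.
have /asboolP[N fN] := lcoefP f; exists `|N|%N => K NK; apply: val_inj.
apply/funext => m /=; rewrite /zshift /lowered; case E: (m + K%:Z) => [k|k] /=.
  by congr (lcoef f _); lia.
by apply: fN; lia.
Qed.

End LaurentShift.

(** x^(-K) a times x^(-K') c is x^(-K-K') times the Cauchy product; this removes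
    the sums over the integers from the algebra L(n, alpha). *)
Lemma lconv_shift (R1 R2 R3 : pzRingType) (U : lmodType R1) (V : lmodType R2)
    (Z : lmodType R3) (beta : U -> V -> Z) K K' a c : biadditive beta ->
  lconv beta (zshift K a) (zshift K' c) = zshift (K + K') (psconv beta a c).
Proof.
move=> badd; apply/funext => m; rewrite /lconv /zshift.
(* In negative total degree one of the two factors vanishes at each index. *)
case E: (m + (K + K')%:Z) => [M|M] /=; last first.
  apply: fsbig1 => i _; case Ei: (i + K%:Z) => [k|k] /=; last by rewrite biadd0r.
  by case Ej: (m - i + K'%:Z) => [l|l] /=; rewrite ?biaddr0//; lia.
rewrite (@fsum_inj _ _ 'I_M.+1 (fun j => (j : nat)%:Z - K%:Z)) /=; last 2 first.
- by move=> j j' /= jj'; apply: val_inj => /=; lia.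
- move=> i iN; case Ei: (i + K%:Z) => [k|k] /=; last by rewrite biadd0r.
  case Ej: (m - i + K'%:Z) => [l|l] /=; rewrite ?biaddr0//.
  have kM : (k < M.+1)%N by lia.
  by case: (iN (Ordinal kM)) => /=; lia.
apply: eq_bigr => j _; rewrite subrK /=.
have -> : m - (j%:Z - K%:Z) + K'%:Z = (M - j)%N by have := ltn_ord j; lia.
by [].
Qed.

Lemma tconv_psconv n (U V Z : zmodType) (beta : U -> V -> Z)
    (a : nat -> U) (c : nat -> V) :
  tconv beta (fun i : 'I_n => a i) (fun i : 'I_n => c i) =
    fun m : 'I_n => psconv beta a c m.
Proof.
by apply/funext => m; rewrite (psconv_pairs _ _ _ (ltn_ord m)).
Qed.

Lemma lie_biadditive (F : fieldType) (g : lieAlgType F) : biadditive (@lie F g).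
Proof.
split=> [x y z|z x y].
  by have := lie_linearr x 1 y z; rewrite !scale1r.
by have := lie_linearl z 1 x y; rewrite !scale1r.
Qed.

Lemma scale_biadditive (R : pzRingType) (V : lmodType R) :
  biadditive ( *:%R : R -> V -> V).
Proof. by split=> [x y z|z x y]; rewrite (scalerDr, scalerDl). Qed.

Lemma mul_biadditive (R : pzRingType) : biadditive ( *%R : R -> R -> R).
Proof. by split=> [x y z|z x y]; rewrite (mulrDr, mulrDl). Qed.

Section Loops.
Variables (F : fieldType) (g : lieAlgType F) (n : nat).
Implicit Types (a c : nat -> g) (v w : loop g n).

(** The element (x^(-K) a, [c]) of L(n, alpha).  Every element has this form, with
    c a power series rather than a truncated one, so that both components are
    handled by Cauchy products. *)
Definition loop_of (K : nat) a c : loop g n :=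
  (lshift K a, fun i : 'I_n => c i).

(** The bound K0 lets two elements be written with the same K. *)
Lemma loop_ofP v : exists K0 c, forall K, (K0 <= K)%N ->
  exists a, v = loop_of K a c.
Proof.
have [K0 vK] := loweredK v.1.
exists K0, (fun k => if insub k is Some i then v.2 i else 0) => K KK0.
exists (lowered K v.1); rewrite /loop_of -vK//; case: v {vK} => f p /=.
by congr (_, _); apply/funext => i; rewrite valK.
Qed.

Lemma loop_of_linear K x a a' c c' :
  loop_of K (x *: a + a') (x *: c + c') = x *: loop_of K a c + loop_of K a' c'.
Proof.
rewrite /loop_of /GRing.scale/= /GRing.add /=; congr (_, _).
apply: val_inj; apply/funext => m /=; rewrite /GRing.add/= /GRing.scale/= /zshift.
by case: (m + K%:Z) => //= k; rewrite scaler0 addr0.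
Qed.

Lemma loop_of0 K : loop_of K 0 0 = 0.
Proof.
have := loop_of_linear K (-1) 0 0 0 0.
by rewrite !scaler0 !addr0 scaleN1r addNr.
Qed.

Lemma diagE a : diag n a = loop_of 0 a a.
Proof.
rewrite /diag /loop_of; congr (_, _); apply: val_inj; apply/funext => m /=.
by rewrite /zshift addr0.
Qed.

Lemma loop_lieE K K' a c a' c' :
  loop_lie (loop_of K a c) (loop_of K' a' c') =
    loop_of (K + K') (ps_lie a a') (ps_lie c c').
Proof.
rewrite /loop_lie/= /loop_of; congr (_, _).
  by apply: val_inj; rewrite /= lconv_shift//; exact: lie_biadditive.
by rewrite tconv_psconv.
Qed.

Lemma loop_actE u K a c :
  loop_act u (loop_of K a c) = loop_of K (psconv *:%R u a) (psconv *:%R u c).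
Proof.
rewrite /loop_act/= /loop_of; congr (_, _); last by rewrite -tconv_psconv.
apply: val_inj => /=.
have -> : zext (u : nat -> F^o) = zshift 0 (u : nat -> F^o).
  by apply/funext => m; rewrite /zshift addr0.
exact: (@lconv_shift F F F F^o g g *:%R 0 K u a (scale_biadditive g)).
Qed.

End Loops.

(** * The Killing form *)

Section Killing.
Import passmx.
Variables (F : fieldType) (g : lieAlgType F).
Implicit Types x y z : g.

Lemma adE x y : ad x y = lie x y.
Proof.
pose f : {linear g -> g} := HB.pack (lie x)
  (GRing.isLinear.Build F g g *:%R (lie x) (lie_linearr x)).
by rewrite /ad -[lie x]/(f : g -> g) lfunE.
Qed.

Lemma lieC x y : lie x y = - lie y x.
Proof.
have [addr addl] := lie_biadditive g.
apply/eqP; rewrite -addr_eq0; apply/eqP.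
by have := liexx (x + y); rewrite addr !addl !liexx add0r addr0 addrC.
Qed.

Lemma ad_lie x y : ad (lie x y) = ((ad x \o ad y) - (ad y \o ad x))%VF.
Proof.
apply/lfunP => z; rewrite !lfunE/= !lfunE/= !lfunE/= !adE.
have := lie_jacobi x y z; rewrite (lieC z (lie x y)) (lieC z x).
have -> : lie y (- lie x z) = - lie y (lie x z).
  by apply: (addIr (lie y (lie x z))); rewrite -(lie_biadditive g).1 !addNr liex0.
by move/eqP; rewrite subr_eq0 => /eqP<-.
Qed.

Lemma ad_linear : linear (@ad F g).
Proof.
move=> k x y; apply/lfunP => z; rewrite !lfunE/= !lfunE/= !adE.
exact: lie_linearl z k x y.
Qed.

Lemma mx_ad_comp (e : (\dim {:g}).-tuple g) x y : basis_of {:g} e ->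
  mxof e e (ad x \o ad y)%VF =
    mxof e e (ad y) *m mxof e e (ad x).
Proof. by move=> eb; rewrite (mxof_comp e e eb). Qed.

Let e := vbasis {:g}.
Let eb : basis_of {:g} e := vbasisP _.
Let M x := mxof e e (ad x).

Let M_linear : linear M.
Proof. by move=> k x y; rewrite /M ad_linear linearP. Qed.

Let killingE x y : killing x y = \tr (M y *m M x).
Proof. by rewrite /killing mx_ad_comp. Qed.

Lemma killing_linearl z k x y :
  killing (k *: x + y) z = k * killing x z + killing y z.
Proof.
by rewrite !killingE M_linear mulmxDr -scalemxAr mxtraceD mxtraceZ.
Qed.

Lemma killingC x y : killing x y = killing y x.
Proof. by rewrite !killingE mxtrace_mulC. Qed.

Lemma killing_biadditive : biadditive (@killing F g).
Proof.
split=> [x y z|z x y]; last by have := killing_linearl z 1 x y; rewrite scale1r mul1r.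
by rewrite !(killingC x); have := killing_linearl x 1 y z; rewrite scale1r mul1r.
Qed.

Lemma killing0l x : killing 0 x = 0.
Proof. exact: (biadd0r killing_biadditive). Qed.

Lemma killing0r x : killing x 0 = 0.
Proof. exact: (biaddr0 killing_biadditive). Qed.

Lemma killingZl k x y : killing (k *: x) y = k * killing x y.
Proof. by rewrite -[k *: x]addr0 killing_linearl killing0l addr0. Qed.

Lemma killingZr k x y : killing x (k *: y) = k * killing x y.
Proof. by rewrite !(killingC x) killingZl. Qed.

Lemma killingNl x y : killing (- x) y = - killing x y.
Proof. by rewrite -scaleN1r killingZl mulN1r. Qed.

(** tr([x, y] z) = tr(x [y, z]) for the matrices of the adjoint maps, by cyclicity
    of the trace; matrices act on rows, which reverses products. *)
Lemma killing_inv x y z : killing (lie x y) z = killing x (lie y z).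
Proof.
have Mlie v w : M (lie v w) = M w *m M v - M v *m M w.
  by rewrite /M ad_lie linearB/= !mx_ad_comp.
rewrite !killingE !Mlie mulmxBr mulmxBl !raddfB/= !mulmxA; congr (_ - _).
by rewrite mxtrace_mulC mulmxA.
Qed.

End Killing.

(** * The invariant form on L(n, alpha) *)

Section Residue.
Variables (F : fieldType) (n : nat) (alpha : int -> F).
Local Notation xa := (xn_alpha n alpha).
Implicit Types f p : nat -> F.

(** The coefficient of index m - 1, with value 0 at m = 0: the residue of
    alpha x^(-K) f is the coefficient of index K + n - 1 of x^n alpha f, and
    K + n may be 0. *)
Definition precoef f (m : nat) : F := if m is m'.+1 then f m' else 0.

Lemma precoef0 m : precoef (fun _ => 0) m = 0.
Proof. by case: m. Qed.

Lemma precoef_psconv f m :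
  precoef (psconv *%R xa f) m = \sum_(j < m) xa j * f (m.-1 - j)%N.
Proof. by case: m => [|m] /=; rewrite ?big_ord0. Qed.

Lemma tcoef_restr p (m : int) :
  tcoef (fun i : 'I_n => p i : F^o) m =
    if m is Posz k then if (k < n)%N then p k else 0 else 0.
Proof.
rewrite /tcoef; case: m => k; last by rewrite big1.
case: ifPn => kn; last by rewrite big1// => i /eqP[]; have := ltn_ord i; lia.
by rewrite (big_pred1 (Ordinal kn)).
Qed.

(** Only the coefficients of p of index below n enter the second residue: no
    truncation modulo x^n is left in the formula. *)
Lemma tresE K f p :
  tres alpha (@zshift F F^o K f) (fun i : 'I_n => p i) =
    precoef (psconv *%R xa f) (K + n) - precoef (psconv *%R xa p) n.
Proof.
(* alpha starts in degree - n, and f in degree - K; p is a polynomial. *)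
rewrite /tres (@fsum_inj _ _ 'I_(K + n) (fun j => (j : nat)%:Z - n%:Z)) /=.
- rewrite !precoef_psconv.
  rewrite (big_ord_widen (K + n) (fun j => xa j * p (n.-1 - j)%N)) ?leq_addl//.
  rewrite [X in _ = _ - X]big_mkcond/= -sumrB; apply: eq_bigr => j _.
  have jn := ltn_ord j; rewrite tcoef_restr /zshift mulrBr; congr (_ * _ - _).
    by have -> : -1 - (j%:Z - n%:Z) + K%:Z = ((K + n).-1 - j)%N by lia.
  case: ltnP => jn'.
    have -> : -1 - (j%:Z - n%:Z) = (n.-1 - j)%N by lia.
    by rewrite ifT//; lia.
  by case E: (-1 - (j%:Z - n%:Z)) => [k|k]; rewrite ?mulr0//; lia.
- by move=> j j' /= jj'; apply: val_inj => /=; lia.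
- move=> m mN; rewrite /alpha_coef; case: ltP => [|mn]; first by rewrite mul0r.
  case E: (-1 - m + K%:Z) => [k|k].
    have jm : (`|(m + n%:Z)%R| < K + n)%N by lia.
    by case: (mN (Ordinal jm)) => /=; lia.
  rewrite /zshift E tcoef_restr /=; case E': (-1 - m) => [l|l]; first by lia.
  by rewrite subr0 mulr0.
Qed.

End Residue.

Section Form.
Variables (F : fieldType) (g : lieAlgType F) (n : nat) (alpha : int -> F).
Local Notation xa := (xn_alpha n alpha).
Local Notation B := (@Bform F g n alpha).
Local Notation psk := (psconv (@killing F g)).
Implicit Types (k : F) (v w : loop g n).

(** The two residues for the form: B is computed from Cauchy products alone.  On
    Delta, where K = K' = 0 and the two components agree, they cancel. *)
Lemma BformE K K' a c a' c' :
  B (loop_of n K a c) (loop_of n K' a' c') =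
    precoef (psconv *%R xa (psk a a')) (K + K' + n) -
    precoef (psconv *%R xa (psk c c')) n.
Proof.
rewrite /Bform/= tconv_psconv -tresE; congr (tres alpha _ _).
exact: (@lconv_shift F F F g g F^o _ K K' a a' (killing_biadditive g)).
Qed.

Lemma BformC v w : B v w = B w v.
Proof.
have [K0 [c vE]] := loop_ofP v; have [K0' [c' wE]] := loop_ofP w.
have [a ->] := vE _ (leqnn _); have [a' ->] := wE _ (leqnn _).
have pskC x y : psk x y = psk y x.
  apply/funext => m; rewrite psconvC; apply: eq_bigr => i _; exact: killingC.
by rewrite !BformE [in RHS](addnC K0') (pskC a) (pskC c).
Qed.

Lemma loop_of2P (v w : loop g n) : exists K a c a' c',
  v = loop_of n K a c /\ w = loop_of n K a' c'.
Proof.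
have [K0 [c vE]] := loop_ofP v; have [K0' [c' wE]] := loop_ofP w.
have [a ->] := vE _ (leq_maxl K0 K0'); have [a' ->] := wE _ (leq_maxr K0 K0').
by exists (maxn K0 K0'), a, c, a', c'.
Qed.

Lemma Bform_linear k v v' w : B (k *: v + v') w = k * B v w + B v' w.
Proof.
have [K [a [c [a' [c' [-> ->]]]]]] := loop_of2P v v'.
have [K0 [e wE]] := loop_ofP w; have [d ->] := wE _ (leqnn _).
rewrite -loop_of_linear !BformE.
have pskD (x y z : nat -> g) :
    psk (k *: x + y) z = fun m => k * psk x z m + psk y z m.
  apply/funext => m; rewrite /psconv mulr_sumr -big_split /=.
  by apply: eq_bigr => i _; exact: killing_linearl.
have xaD (x y : nat -> F) m :
    precoef (psconv *%R xa (fun m => k * x m + y m)) m =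
    k * precoef (psconv *%R xa x) m + precoef (psconv *%R xa y) m.
  case: m => [|m] /=; first by rewrite mulr0 addr0.
  rewrite /psconv mulr_sumr -big_split /=; apply: eq_bigr => i _.
  by rewrite mulrDr mulrCA.
by rewrite !pskD !xaD; ring.
Qed.

Lemma Bform_inv v w w' : B (loop_lie v w) w' = B v (loop_lie w w').
Proof.
have [K0 [c vE]] := loop_ofP v; have [a ->] := vE _ (leqnn _).
have [K1 [c' wE]] := loop_ofP w; have [a' ->] := wE _ (leqnn _).
have [K2 [c'' w'E]] := loop_ofP w'; have [a'' ->] := w'E _ (leqnn _).
have pskA (x y z : nat -> g) : psk (ps_lie x y) z = psk x (ps_lie y z).
  apply/funext => m; symmetry; apply: psconvA; try exact: killing_biadditive.
  by move=> x' y' z'; rewrite killing_inv.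
by rewrite !loop_lieE !BformE !pskA !addnA.
Qed.

Lemma Bform_diag a c : B (diag n a) (diag n c) = 0.
Proof. by rewrite !diagE BformE subrr. Qed.

Lemma loop_lie_linear k v v' w :
  loop_lie (k *: v + v') w = k *: loop_lie v w + loop_lie v' w.
Proof.
have [K [a [c [a' [c' [-> ->]]]]]] := loop_of2P v v'.
have [K0 [e wE]] := loop_ofP w; have [d ->] := wE _ (leqnn _).
have lD (x y z : nat -> g) : ps_lie (k *: x + y) z = k *: ps_lie x z + ps_lie y z.
  apply/funext => m; rewrite /ps_lie /psconv /GRing.add/= /GRing.scale/=.
  rewrite scaler_sumr -big_split /=; apply: eq_bigr => i _.
  exact: lie_linearl.
by rewrite -loop_of_linear !loop_lieE !lD loop_of_linear.
Qed.

Lemma loop_lieC v w : loop_lie v w = - loop_lie w v.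
Proof.
have [K0 [c vE]] := loop_ofP v; have [a ->] := vE _ (leqnn _).
have [K1 [c' wE]] := loop_ofP w; have [a' ->] := wE _ (leqnn _).
have lC (x y : nat -> g) : ps_lie x y = -1 *: ps_lie y x + 0.
  apply/funext => m; rewrite /ps_lie psconvC /psconv.
  rewrite /GRing.add/= /GRing.scale/= addr0 scaler_sumr.
  by apply: eq_bigr => i _; rewrite scaleN1r lieC.
rewrite !loop_lieE addnC (lC a) (lC c) loop_of_linear -scaleN1r.
by rewrite loop_of0 addr0.
Qed.

Lemma loop_jacobi v w w' :
  loop_lie v (loop_lie w w') + loop_lie w (loop_lie w' v)
    + loop_lie w' (loop_lie v w) = 0.
Proof.
have [K0 [c vE]] := loop_ofP v; have [a ->] := vE _ (leqnn _).
have [K1 [c' wE]] := loop_ofP w; have [a' ->] := wE _ (leqnn _).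
have [K2 [c'' w'E]] := loop_ofP w'; have [a'' ->] := w'E _ (leqnn _).
have jac (x y z : nat -> g) :
    ps_lie x (ps_lie y z) + ps_lie y (ps_lie z x) + ps_lie z (ps_lie x y) = 0.
  apply/funext => m; rewrite /GRing.add/= /ps_lie.
  rewrite !psconv_nestr; try exact: lie_biadditive.
  rewrite [X in _ + X + _]psconv3_rot [X in _ + X + _]psconv3_rot.
  rewrite [X in _ + _ + X]psconv3_rot /psconv3 -!big_split big1// => i _.
  rewrite -!big_split big1// => j _; rewrite -!big_split big1// => k _.
  exact: lie_jacobi.
set K := (K0 + (K1 + K2))%N.
have KE1 : (K1 + (K2 + K0) = K)%N by lia.
have KE2 : (K2 + (K0 + K1) = K)%N by lia.
rewrite !loop_lieE KE1 KE2 -/K.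
have addE x y z t : loop_of n K x y + loop_of n K z t = loop_of n K (x + z) (y + t).
  by rewrite -[loop_of n K x y]scale1r -loop_of_linear !scale1r.
by rewrite !addE !jac loop_of0.
Qed.

End Form.

(** * Lagrangian decompositions of a quadratic Lie algebra *)

Section Quadratic.
Variables (F : fieldType) (L : lmodType F) (br : L -> L -> L) (B : L -> L -> F).

Record quadratic_lie : Prop := {
  br_linearl : forall k x y z, br (k *: x + y) z = k *: br x z + br y z;
  brC : forall x y, br x y = - br y x;
  br_jacobi : forall x y z, br x (br y z) + br y (br z x) + br z (br x y) = 0;
  form_linearl : forall k x y z, B (k *: x + y) z = k * B x z + B y z;
  formC : forall x y, B x y = B y x;
  form_inv : forall x y z, B (br x y) z = B x (br y z) }.

Hypothesis Q : quadratic_lie.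

Lemma form0l x : B 0 x = 0.
Proof. by have := form_linearl Q (-1) 0 0 x; rewrite scaler0 addr0 mulN1r addNr. Qed.

Lemma formDl x y z : B (x + y) z = B x z + B y z.
Proof. by rewrite -[x]scale1r form_linearl// scale1r mul1r. Qed.

Lemma formZl k x z : B (k *: x) z = k * B x z.
Proof. by rewrite -[k *: x]addr0 form_linearl// form0l addr0. Qed.

Lemma formNl x z : B (- x) z = - B x z.
Proof. by rewrite -scaleN1r formZl mulN1r. Qed.

Lemma formDr x y z : B z (x + y) = B z x + B z y.
Proof. by rewrite !(formC Q z) formDl. Qed.

Lemma formNr x z : B z (- x) = - B z x.
Proof. by rewrite !(formC Q z) formNl. Qed.

Lemma formZr k x z : B z (k *: x) = k * B z x.
Proof. by rewrite !(formC Q z) formZl. Qed.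

Lemma form_sumr x T (E : T -> L) (l : seq T) :
  B x (\sum_(t <- l) E t) = \sum_(t <- l) B x (E t).
Proof.
apply: (big_morph (B x)) => [y z|]; first exact: formDr.
by rewrite formC// form0l.
Qed.

Lemma brDl x y z : br (x + y) z = br x z + br y z.
Proof. by rewrite -[x]scale1r br_linearl// !scale1r. Qed.

Lemma br0l x : br 0 x = 0.
Proof. by have := br_linearl Q (-1) 0 0 x; rewrite scaler0 addr0 scaleN1r addNr. Qed.

Lemma brNl x z : br (- x) z = - br x z.
Proof. by rewrite -[- x]addr0 -scaleN1r br_linearl// scaleN1r br0l addr0. Qed.

Lemma brDr x y z : br z (x + y) = br z x + br z y.
Proof. by rewrite brC// brDl opprD -!(brC Q z). Qed.

Lemma brNr x z : br z (- x) = - br z x.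
Proof. by rewrite brC// brNl -(brC Q z). Qed.

Lemma form_cyc x y z : B (br x y) z = B (br y z) x.
Proof. by rewrite form_inv// formC. Qed.

Lemma form_br_sum (T T' : finType) (c : T -> F) (c' : T' -> F) (r : T -> L)
    (r' : T' -> L) w :
  B (br (\sum_x c x *: r x) (\sum_y c' y *: r' y)) w =
    \sum_x \sum_y B (br (r x) (r' y)) w * (c x * c' y).
Proof.
rewrite form_cyc form_sumr; apply: eq_bigr => x _.
rewrite formZr form_cyc form_sumr mulr_sumr; apply: eq_bigr => y _.
by rewrite formZr form_cyc; ring.
Qed.

End Quadratic.

Section LagrangianFrame.
Variables (F : fieldType) (L : lmodType F) (br : L -> L -> L) (B : L -> L -> F).
Variables (I : Type) (D : (I -> F) -> L) (r : I -> L).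

(** The projection onto the Lagrangian subalgebra D along the span of the r_p. *)
Definition Dproj v := D (fun p => B (r p) v).

(** D parametrizes an isotropic subalgebra by coordinates, and r is the family
    dual to these coordinates in an isotropic complement.  Complementarity is
    kept only as polarization: a vector minus its projection pairs to zero
    with another such difference. *)
Record lagrangian_frame : Prop := {
  fr_opp : forall a, D (fun p => - a p) = - D a;
  fr_isoD : forall a c, B (D a) (D c) = 0;
  fr_dual : forall p a, B (r p) (D a) = a p;
  fr_isor : forall p q, B (r p) (r q) = 0;
  fr_sub : forall a c, br (D a) (D c) = Dproj (br (D a) (D c));
  fr_polar : forall v w, B v w = B v (Dproj w) + B (Dproj v) w }.

(** The cobracket and the associator attached to the frame, in coordinates, and
    the bracket of the subalgebra in the same coordinates. *)
Definition cobr a p q := B (br (r p) (r q)) (D a).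
Definition cophi p q z := - B (br (r p) (r q)) (r z).
Definition coord_br a c p := B (r p) (br (D a) (D c)).

Hypothesis Q : quadratic_lie br B.
Hypothesis fr : lagrangian_frame.

Lemma cobr_skew a p q : cobr a q p = - cobr a p q.
Proof. by rewrite /cobr (brC Q) (formNl Q). Qed.

Lemma cophi_skew p q z : [/\ cophi q p z = - cophi p q z,
  cophi p z q = - cophi p q z & cophi z q p = - cophi p q z].
Proof.
have swap12 x y t : cophi y x t = - cophi x y t.
  by rewrite /cophi (brC Q) (formNl Q).
have cyc x y t : cophi x y t = cophi y t x by rewrite /cophi (form_cyc Q).
by split; [|rewrite (cyc p z q) swap12 -cyc|rewrite swap12 -cyc].
Qed.

Lemma Dproj_opp v : Dproj (- v) = - Dproj v.
Proof.
by rewrite -(fr_opp fr); congr D; apply/funext => p; rewrite (formNr Q).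
Qed.

(** Freezing all indices but one in the structure tensors gives the coordinates of
    a projected bracket; these five lemmas turn contractions of the structure
    tensors into pairings of brackets. *)
Lemma D_cobrl c q : D (cobr c ^~ q) = Dproj (br (r q) (D c)).
Proof. by congr D; apply/funext => p; rewrite /cobr (form_inv Q). Qed.

Lemma D_cobrr c p : D (cobr c p) = - Dproj (br (r p) (D c)).
Proof.
rewrite -Dproj_opp; congr D; apply/funext => q.
by rewrite cobr_skew /cobr (form_inv Q) (formNr Q).
Qed.

Lemma D_cophi1 q z : D (fun p => cophi p q z) = - Dproj (br (r q) (r z)).
Proof.
rewrite -Dproj_opp; congr D; apply/funext => p.
by rewrite /cophi (form_inv Q) (formNr Q).
Qed.

Lemma D_cophi2 p z : D (fun q => cophi p q z) = - Dproj (br (r z) (r p)).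
Proof.
by rewrite -D_cophi1; congr D; apply/funext => q; rewrite /cophi (form_cyc Q).
Qed.

Lemma D_cophi3 p q : D (fun z => cophi p q z) = - Dproj (br (r p) (r q)).
Proof.
by rewrite -D_cophi1; congr D; apply/funext => z; rewrite /cophi -(form_cyc Q).
Qed.

Lemma form_br_jacobi x y z w :
  B (br x y) (br z w) + B (br x z) (br w y) + B (br x w) (br y z) = 0.
Proof.
by rewrite !(form_inv Q) -!(formDr Q) (br_jacobi Q) (formC Q) (form0l Q).
Qed.

Lemma form_polar v w : B v (Dproj w) + B w (Dproj v) = B v w.
Proof. by rewrite (formC Q w) -(fr_polar fr). Qed.

(** Compatibility of cobracket and bracket.  With X_p = [r_p, a] and
    Y_q = [r_q, c], the four terms on the right are the halves, by
    polarization, of B(X_p, Y_q) - B(X_q, Y_p), which is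
    B([r_p, r_q], [a, c]) by the Jacobi identity. *)
Lemma cobr_cocycle a c p q : cobr (coord_br a c) p q =
  (coord_br a (cobr c ^~ q) p + coord_br a (cobr c p) q) -
  (coord_br c (cobr a ^~ q) p + coord_br c (cobr a p) q).
Proof.
rewrite /coord_br !D_cobrl !D_cobrr !(brNr Q) !(formNr Q) -!(form_inv Q).
rewrite [LHS](_ : _ = B (br (r p) (r q)) (br (D a) (D c))); last first.
  by rewrite /cobr [in RHS](fr_sub fr).
have := form_br_jacobi (r p) (r q) (D a) (D c).
rewrite (brC Q (D c) (r q)) (formNr Q).
rewrite -(form_polar (br (r p) (D a))) -(form_polar (br (r p) (D c))).
(* The difference of the two sides is the left side of the Jacobi identity. *)
move=> jac; apply/eqP; rewrite -subr_eq0 -[eqbRHS]jac; apply/eqP; ring.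
Qed.

(** The two sides hold the two halves, by polarization, of the cyclic sum of
    B([r_p, r_q], [r_z, a]), which vanishes by the Jacobi identity. *)
Lemma cobr_cojacobi a p q z :
  cobr (cobr a ^~ z) p q + cobr (cobr a ^~ p) q z + cobr (cobr a ^~ q) z p =
  coord_br a (fun p' => cophi p' q z) p + coord_br a (fun q' => cophi p q' z) q +
  coord_br a (fun z' => cophi p q z') z.
Proof.
rewrite /coord_br D_cophi1 D_cophi2 D_cophi3 !(brNr Q) !(formNr Q) -!(form_inv Q).
rewrite /cobr !D_cobrl.
have := form_br_jacobi (D a) (r p) (r q) (r z).
rewrite !(brC Q (D a)) !(formNl Q).
rewrite -(form_polar (br (r p) (D a))) -(form_polar (br (r q) (D a))).
rewrite -(form_polar (br (r z) (D a))).
move=> jac; apply/eqP; rewrite -subr_eq0 -[eqbRHS]oppr0 -jac; apply/eqP; ring.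
Qed.

(** The contraction of the cobracket with the associator is not zero, but its
    symmetrization is a full pairing of two brackets, whose sum over the three
    pairings of four indices vanishes by [form_br_jacobi]. *)
Lemma cobr_cophi p q z w :
  cobr (fun t => cophi t z w) p q + cobr (fun t => cophi t p q) z w =
  - B (br (r p) (r q)) (br (r z) (r w)).
Proof.
by rewrite /cobr !D_cophi1 !(formNr Q) -[in RHS]form_polar opprD.
Qed.

Section Twist.
Variable s : I -> I -> F.
Hypothesis s_skew : forall p q, s q p = - s p q.
Let T q := D (s ^~ q).
Let r_s p := r p - T p.

Let D_row p : D (s p) = - T p.
Proof.
by rewrite -(fr_opp fr); congr D; apply/funext => q; rewrite -s_skew.
Qed.

Let form_D3 a c e : B (br (D a) (D c)) (D e) = 0.
Proof. by rewrite (fr_sub fr) (fr_isoD fr). Qed.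

(** The term without r drops out because D spans an isotropic subalgebra; the two
    terms with one r are the action of a on s. *)
Lemma cobr_twist a p q : B (br (r_s p) (r_s q)) (D a) =
  cobr a p q + (coord_br a (s ^~ q) p + coord_br a (s p) q).
Proof.
rewrite /coord_br /cobr D_row -/(T q) /r_s.
rewrite !(brDl Q, brDr Q, brNl Q, brNr Q, formDl Q, formNl Q, formNr Q) form_D3.
rewrite (form_inv Q (r p) (T q)) (brC Q (T q)) (formNr Q).
rewrite (form_cyc Q (T p)) (form_inv Q (r q)).
ring.
Qed.

(** Sorted by the number of factors from the subalgebra: none gives the old
    associator, one gives the cobracket of the columns of s, two give the
    Yang-Baxter expression of s, three give 0. *)
Lemma cophi_twist p q z : - B (br (r_s p) (r_s q)) (r_s z) =
  cophi p q z
  - (coord_br (s ^~ q) (s ^~ z) p + coord_br (s p) (s ^~ z) q + coord_br (s p) (s q) z)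
  + (cobr (s ^~ z) p q + cobr (s ^~ p) q z + cobr (s ^~ q) z p).
Proof.
rewrite /coord_br /cobr /cophi !D_row -/(T p) -/(T q) -/(T z) /r_s.
rewrite !(brDl Q, brDr Q, brNl Q, brNr Q).
rewrite !(formDl Q, formNl Q, formDr Q, formNr Q) form_D3.
rewrite (form_inv Q (r p) (T q) (T z)) (formC Q (br (T p) (T q))).
rewrite (form_cyc Q (T p) (r q) (T z)) (form_inv Q (r q)) (brC Q (T z)) (formNr Q).
rewrite (form_cyc Q (T p) (r q) (r z)) -(form_cyc Q (r z) (r p) (T q)).
ring.
Qed.

End Twist.
End LagrangianFrame.

(** * Alternation over three and four factors *)

Section Alternation.
Variables (F : fieldType) (g : lieAlgType F).

Lemma sum_sign_mulg n (t : 'S_n) (f : 'S_n -> F) : ~~ odd_perm t ->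
  \sum_(s : 'S_n) (-1) ^+ s * f (t * s)%g = \sum_(s : 'S_n) (-1) ^+ s * f s.
Proof.
move=> t_even; rewrite [RHS](reindex_inj (mulgI t)); apply: eq_bigr => s _.
by rewrite odd_permM (negbTE t_even).
Qed.

(** Each of the three cyclic terms is reached by two permutations; this accounts
    for the factor 1/2 in front of the alternations of the statement. *)
Lemma alt3_skew12 (T : tens3 g) p q z :
    (forall p q z, T q p z = - T p q z) ->
  alt3 T p q z = 2%:R * (T p q z + T q z p + T z p q).
Proof.
move=> T_skew; rewrite /alt3.
pose i0 := @Ordinal 3 0 isT; pose i1 := @Ordinal 3 1 isT; pose i2 := @Ordinal 3 2 isT.
have -> : inord 0 = i0 by apply: val_inj; rewrite /= inordK.
have -> : inord 1 = i1 by apply: val_inj; rewrite /= inordK.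
have -> : inord 2 = i2 by apply: val_inj; rewrite /= inordK.
pose S3 := [:: 1; tperm i0 i1; tperm i0 i1 * tperm i0 i2; tperm i0 i2;
  tperm i0 i2 * tperm i0 i1; tperm i1 i2]%g.
(* S_3 is enumerated: the six permutations differ on i0, i1, and there are 3! *)
have S3_uniq : uniq S3.
  apply: (@map_uniq _ _ (fun s : 'S_3 => (s i0, s i1))).
  by rewrite /S3 /= !permM !permE.
have S3_all : perm_eq (index_enum 'S_3) S3.
  have S3_sub : {subset S3 <= enum {perm 'I_3}} by move=> s _; rewrite mem_enum.
  have [|_ S3E] := uniq_min_size S3_uniq S3_sub; first by rewrite -cardE card_Sn.
  apply: uniq_perm; rewrite ?index_enum_uniq// => s.
  by rewrite mem_index_enum S3E mem_enum.
rewrite (perm_big _ S3_all) /S3 !big_cons big_nil !odd_permM !odd_tperm odd_perm1.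
rewrite !permM !permE /= !(tnth_nth p) /=.
rewrite (T_skew q p) (T_skew z q) (T_skew z p).
ring.
Qed.

(** The six composites of the identity or the double transposition (02)(13) with a
    power of the 3-cycle (123) are even permutations, so the alternation of T is
    unchanged when one of them is applied to the arguments; the sum over the
    six is 0. *)
Lemma alt4_eq0 (T : tens4 g) : [pchar F] =i pred0 ->
    (forall p q z w, (T p q z w + T z w p q) + (T p z w q + T w q p z)
       + (T p w q z + T q z p w) = 0) ->
  forall p q z w, alt4 T p q z w = 0.
Proof.
move=> charF T_cyc p q z w; rewrite /alt4.
pose i0 := @Ordinal 4 0 isT; pose i1 := @Ordinal 4 1 isT.
pose i2 := @Ordinal 4 2 isT; pose i3 := @Ordinal 4 3 isT.
have -> : inord 0 = i0 by apply: val_inj; rewrite /= inordK.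
have -> : inord 1 = i1 by apply: val_inj; rewrite /= inordK.
have -> : inord 2 = i2 by apply: val_inj; rewrite /= inordK.
have -> : inord 3 = i3 by apply: val_inj; rewrite /= inordK.
set P := tnth _.
pose f (s : 'S_4) := T (P (s i0)) (P (s i1)) (P (s i2)) (P (s i3)).
have evenM (t t' : 'S_4) : ~~ odd_perm t -> ~~ odd_perm t' -> ~~ odd_perm (t * t')%g.
  by move=> tE t'E; rewrite odd_permM (negbTE tE).
have [c c_even cE] : exists2 c : 'S_4, ~~ odd_perm c &
    forall s : 'S_4, (((c * s)%g i0 = s i0) * ((c * s)%g i1 = s i2) *
      ((c * s)%g i2 = s i3) * ((c * s)%g i3 = s i1))%type.
  exists (tperm i1 i2 * tperm i1 i3)%g; first by rewrite odd_permM !odd_tperm.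
  by move=> s; rewrite !permM !permE.
have [d d_even dE] : exists2 d : 'S_4, ~~ odd_perm d &
    forall s : 'S_4, (((d * s)%g i0 = s i2) * ((d * s)%g i1 = s i3) *
      ((d * s)%g i2 = s i0) * ((d * s)%g i3 = s i1))%type.
  exists (tperm i0 i2 * tperm i1 i3)%g; first by rewrite odd_permM !odd_tperm.
  by move=> s; rewrite !permM !permE.
have sumE t : ~~ odd_perm t ->
    \sum_(s : 'S_4) (-1) ^+ s * f s = \sum_(s : 'S_4) (-1) ^+ s * f (t * s)%g.
  by move=> t_even; rewrite sum_sign_mulg.
rewrite -[LHS]/(\sum_(s : 'S_4) (-1) ^+ s * f s).
(* Only even permutations occur below, so each copy of A can be reindexed. *)
set A := LHS; have A6 : A *+ 6 = 0.
  rewrite mulrSr mulrSr mulrSr mulrSr mulrSr.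
  rewrite {2}/A (sumE d)// {2}/A (sumE c)// {2}/A (sumE (d * c)%g) ?evenM//.
  rewrite {2}/A (sumE (c * c)%g) ?evenM//.
  rewrite {2}/A (sumE (d * (c * c))%g) ?evenM//.
  rewrite /A -!big_split big1//= => s _; rewrite -!mulrDr /f -!mulgA !dE !cE.
  have := T_cyc (P (s i0)) (P (s i1)) (P (s i2)) (P (s i3)).
  by rewrite !addrA => ->; rewrite mulr0.
apply/eqP; move/eqP: A6; rewrite -mulr_natr mulf_eq0 => /orP[//|].
by rewrite (GRing.pcharf0P F).1.
Qed.

End Alternation.

(** * Coordinates in an orthonormal basis *)

Section Coordinates.
Variables (F : fieldType) (g : lieAlgType F) (b : (\dim {:g}).-tuple g).
Hypothesis b_on : killing_orthonormal_basis b.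

Lemma ps_coordK : cancel (ps_coord b) (ps_of_coord b).
Proof.
move=> a; apply/funext => k; rewrite /ps_of_coord /ps_coord /=.
by rewrite -(coord_basis b_on.1) ?memvf.
Qed.

Lemma ps_of_coordK : cancel (ps_of_coord b) (ps_coord b).
Proof.
move=> c; apply/funext => -[i k]; rewrite /ps_of_coord /ps_coord /=.
by rewrite coord_sum_free ?(basis_free b_on.1).
Qed.

Lemma killing_basis (i : 'I_(\dim {:g})) x : killing b`_i x = coord b i x.
Proof.
rewrite {1}(coord_basis b_on.1 (memvf x)) (biadd_sumr (killing_biadditive g)).
rewrite (bigD1 i)//= big1 ?addr0 => [|j ji]; rewrite killingZr b_on.2.
  by rewrite eqxx mulr1.
by rewrite eq_sym (negbTE ji) mulr0.
Qed.

Lemma ps_coord_mono p q : ps_coord b (bmono b p) q = (q == p)%:R.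
Proof.
case: p q => i k [j l]; rewrite /ps_coord /bmono /= xpair_eqE.
case: (l == k); rewrite ?andbF ?linear0// andbT.
by rewrite coord_free ?(basis_free b_on.1)// eq_sym.
Qed.

End Coordinates.

(** * Pairings with the singular part *)

Section QuasiRMatrix.
Variables (F : fieldType) (g : lieAlgType F) (b : (\dim {:g}).-tuple g).
Hypothesis b_on : killing_orthonormal_basis b.
Variables (n : nat) (alpha : int -> F) (u : nat -> F).
Hypothesis u_inv : ps_inverse u (xn_alpha n alpha).
Local Notation xa := (xn_alpha n alpha).
Local Notation B := (@Bform F g n alpha).
Local Notation psk := (psconv (@killing F g)).
Local Notation e p := (diag n (bmono b p)).

Let mulA := @psconvA F F F F F F *%R *%R *%R *%R.

Lemma psconv_mul1 (f : nat -> F) : psconv *%R (psmono 0 1) f = f.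
Proof.
by apply/funext => m; rewrite psconv_monol ?mul1r ?subn0//; exact: mul_biadditive.
Qed.

Lemma u_xa : psconv *%R u xa = psmono 0 1.
Proof. by apply/funext => m; rewrite u_inv /psmono; case: m. Qed.

Lemma xa_u : psconv *%R xa u = psmono 0 1.
Proof.
rewrite -u_xa; apply/funext => m; rewrite psconvC.
by apply: eq_bigr => i _; rewrite mulrC.
Qed.

(** Multiplication by u = 1 / (x^n alpha) cancels alpha: what remains of the form
    is a difference of two coefficients. *)
Lemma Bform_act K K' a c a' c' :
  B (loop_act u (loop_of n K a c)) (loop_of n K' a' c') =
    precoef (psk a a') (K + K' + n) - precoef (psk c c') n.
Proof.
have kill x y : psconv *%R xa (psk (psconv *:%R u x) y) = psk x y.
  rewrite -[RHS]psconv_mul1 -xa_u; apply/funext => m.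
  rewrite -mulA; try exact: mul_biadditive; try exact: mulrA.
  congr psconv; apply/funext => m'; symmetry.
  apply: psconvA; [exact: mul_biadditive|exact: killing_biadditive|].
  by move=> k z w; rewrite killingZl.
by rewrite loop_actE BformE !kill.
Qed.

Lemma yOmegaE k i : yOmega b n k i =
  if (k < n)%N then loop_of n 0 0 (psmono (n - 1 - k) (- b`_i))
  else loop_of n (k + 1 - n) (psmono 0 b`_i) 0.
Proof.
rewrite /yOmega /loop_of; case: ltnP => kn; congr (_, _).
- by apply: val_inj; apply/funext => m; rewrite /= /zshift; case: (m + _).
- by apply/funext => m; rewrite /tmono /psmono; case: eqP => // _; rewrite oppr0.
apply: val_inj; apply/funext => m; rewrite /= /lmono_coef /zshift.
case E: (m + (k + 1 - n)%:Z) => [l|l] /=; last by rewrite ifN//; lia.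
rewrite /psmono; congr (if _ then _ else _); lia.
Qed.

Let psk0l (a : nat -> g) : psk 0 a = fun _ => 0.
Proof.
apply/funext => m; rewrite /psconv big1// => i _.
exact: (biadd0r (killing_biadditive g)).
Qed.

Lemma singular_diag k i a : B (singular b n u k i) (diag n a) = ps_coord b a (i, k).
Proof.
rewrite /singular yOmegaE diagE; case: ltnP => kn; rewrite Bform_act psk0l precoef0.
  case: n kn => // n' kn /=.
  rewrite psconv_monol; last exact: killing_biadditive.
  rewrite ifT; last lia.
  rewrite killingNl (killing_basis b_on) sub0r opprK.
  by rewrite /ps_coord /=; congr (coord b i (a _)); lia.
rewrite subr0 (_ : _ + _ = k.+1)%N; last lia.
by rewrite /= psconv_monol ?subn0 ?(killing_basis b_on)//; exact: killing_biadditive.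
Qed.

(** Division by x - y: the equation expresses h k (l+1) by h (k+1) l, and h k 0
    directly, so it determines h along each antidiagonal. *)
Lemma mul_xsuby_solution (h : nat -> nat -> F) :
    (forall k l, mul_xsuby h k l = u k *+ (l == n) - u l *+ (k == n)) ->
  forall k l, h k l =
    if (k < n)%N then
      if (l < n)%N then
        if (n - 1 - l <= k)%N then - u (k - (n - 1 - l))%N else 0
      else 0
    else if (l < n)%N then 0 else u (k + l + 1 - n)%N.
Proof.
move=> hE k l.
have h_base k' : h k' 0%N = u k'.+1 *+ (0 == n)%N - u 0%N *+ (k'.+1 == n).
  by rewrite -hE /mul_xsuby subr0.
have h_step k' l' :
    h k' l'.+1 = u k'.+1 *+ (l'.+1 == n) - u l'.+1 *+ (k'.+1 == n) + h k'.+1 l'.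
  by rewrite -hE /mul_xsuby subrK.
elim: l k => [|l IH] k.
  rewrite h_base {hE h_base h_step}.
  case: (eqVneq 0%N n) => n0; case: (eqVneq k.+1 n) => kn;
    rewrite ?mulr1n ?mulr0n ?subr0 ?sub0r; do ?[case: ifP => ?]; try lia;
    by [|congr u; lia|congr (- u _); lia].
rewrite h_step IH {hE h_base h_step IH}.
case: (eqVneq l.+1 n) => ln; case: (eqVneq k.+1 n) => kn;
  rewrite ?mulr1n ?mulr0n ?subr0 ?sub0r ?add0r; do ?[case: ifP => ?]; try lia;
  rewrite ?addr0 //; first [congr u; lia|congr (- u _); lia|idtac];
  by apply/eqP; rewrite 1?[- _ + _]addrC subr_eq0; apply/eqP; congr u; lia.
Qed.

(** The singular part fails to be isotropic by (u(x) y^n - u(y) x^n) / (x - y),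
    the very series that the definition of skew-symmetry corrects for. *)
Lemma singular_form h :
    (forall k l, mul_xsuby h k l = u k *+ (l == n) - u l *+ (k == n)) ->
  forall k l i j, B (singular b n u k i) (singular b n u l j) = (i == j)%:R * h k l.
Proof.
move=> hE k l i j; rewrite (mul_xsuby_solution hE) /singular !yOmegaE.
have actE K K' a c a' c' :
    B (loop_act u (loop_of n K a c)) (loop_act u (loop_of n K' a' c')) =
    precoef (psk a (psconv *:%R u a')) (K + K' + n) -
    precoef (psk c (psconv *:%R u c')) n.
  by rewrite (loop_actE n u K' a' c') Bform_act.
have psk0r a : psk a (psconv *:%R u 0) = fun _ => 0.
  apply/funext => m; rewrite /psconv big1// => p _.
  by rewrite big1 ?killing0r// => q _; rewrite scaler0.
case: ltnP => kn; case: ltnP => ln; rewrite actE ?psk0l ?psk0r ?precoef0.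
- case: n kn ln => // n' kn ln /=; rewrite sub0r.
  rewrite psconv_monol; last exact: killing_biadditive.
  rewrite ifT; last lia.
  rewrite psconv_monor; last exact: scale_biadditive.
  have -> : (n' - (n'.+1 - 1 - k) = k)%N by lia.
  case: ifP => _; last by rewrite killing0r mulr0 oppr0.
  rewrite killingNl killingZr killingC killingNl killingC b_on.2.
  by rewrite mulrN !opprK mulrN mulrC.
- by rewrite subrr mulr0.
- by rewrite subrr mulr0.
rewrite subr0 (_ : _ + _ = (k + l + 1 - n).+1)%N; last lia.
rewrite /= psconv_monol; last exact: killing_biadditive.
rewrite psconv_monor; last exact: scale_biadditive.
by rewrite !subn0 killingZr b_on.2 mulrC.
Qed.

(** Delta is its own orthogonal.  Modulo Delta, v is (x^(-K) a0, 0), and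
    orthogonality kills the coefficients of x^n alpha killing(a0, b_i) below
    degree K + n; multiplying by the inverse u of x^n alpha, it kills those of
    a0, so that x^(-K) a0 is divisible by x^n and (x^(-K) a0, 0) is in Delta. *)
Lemma Delta_perp v : (forall p, B v (e p) = 0) -> exists a, v = diag n a.
Proof.
have [K [c vE]] := loop_ofP v; have [a {vE}->] := vE _ (leqnn _) => v_perp.
pose a0 m := a m - (if (m < K)%N then 0 else c (m - K)%N).
(* Subtract the element of Delta given by the second component. *)
have dec : loop_of n K a c = diag n c + loop_of n K a0 0.
  rewrite diagE /loop_of /GRing.add/=; congr (_, _); last first.
    by apply/funext => i; rewrite /GRing.add/= addr0.
  apply: val_inj; apply/funext => m /=; rewrite /GRing.add/= /zshift addr0.
  case E: (m + K%:Z) => [k|k] /=; last by case: m E => m E; rewrite ?addr0//; lia.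
  case: m E => m E /=; rewrite /a0.
    have -> : (k = m + K)%N by lia.
    by rewrite ltnNge leq_addl addnK addrC subrK.
  have -> : (k < K)%N by lia.
  by rewrite subr0 add0r.
pose q i m := killing (a0 m) b`_i.
have psk_mono (i : 'I_(\dim {:g})) k :
    psk a0 (psmono k b`_i) = psconv *%R (q i) (psmono k 1).
  apply/funext => m; rewrite psconv_monor; last exact: killing_biadditive.
  rewrite psconv_monor; last exact: mul_biadditive.
  by case: ifP => // _; rewrite mulr1.
have xa_q (i : 'I_(\dim {:g})) m : (m < K + n)%N -> psconv *%R xa (q i) m = 0.
  move=> mKn; 
  have preE (f : nat -> F) : precoef f (K + n) = f ((K + n).-1 - m + m)%N.
    by have {1}-> : (K + n = ((K + n).-1 - m + m).+1)%N by lia.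
  have := v_perp (i, (K + n).-1 - m)%N; rewrite dec -[diag n c]scale1r Bform_linear.
  rewrite Bform_diag mulr0 add0r diagE BformE psk0l.
  have -> : precoef (psconv *%R xa (fun _ => 0)) n = 0.
    by case: n => //= n'; rewrite /psconv big1// => l _; rewrite mulr0.
  have -> : bmono b (i, (K + n).-1 - m)%N = psmono ((K + n).-1 - m) b`_i by [].
  rewrite psk_mono subr0 addn0 preE.
  rewrite mulA; try exact: mul_biadditive; try exact: mulrA.
  rewrite psconv_monor; last exact: mul_biadditive.
  by rewrite ifT ?leq_addr// mulr1 addKn.
have a0_0 m : (m < K + n)%N -> a0 m = 0.
  move=> mKn; rewrite (coord_basis b_on.1 (memvf (a0 m))) big1// => i _.
  rewrite -(killing_basis b_on) killingC -/(q i m) -[q i]psconv_mul1 -u_xa.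
  rewrite -mulA; try exact: mul_biadditive; try exact: mulrA.
  rewrite {1}/psconv big1 ?scale0r// => l _; rewrite xa_q ?mulr0//.
  have := ltn_ord l; lia.
exists (c + (fun m => a0 (m + K)%N)); rewrite dec !diagE.
have -> : loop_of n 0 (c + (fun m => a0 (m + K)%N)) (c + (fun m => a0 (m + K)%N)) =
    loop_of n 0 c c + loop_of n 0 (fun m => a0 (m + K)%N) (fun m => a0 (m + K)%N).
  by rewrite -[loop_of n 0 c c]scale1r -loop_of_linear scale1r.
congr (_ + _); rewrite /loop_of; congr (_, _); last first.
  by apply/funext => i; rewrite a0_0//; have := ltn_ord i; lia.
apply: val_inj; apply/funext => m; rewrite /= /zshift addr0.
case: m => m; case E: (_ + K%:Z) => [k|k] //=; try lia.
  by congr a0; lia.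
by apply: a0_0; lia.
Qed.

(** Pairing with Delta sees only finitely many indices. *)
Lemma Bform_mono_bounded v : exists J, forall p, (J <= p.2)%N -> B v (e p) = 0.
Proof.
have [K0 [c vE]] := loop_ofP v; have [a ->] := vE _ (leqnn _).
exists (K0 + n)%N => -[i k] /= kJ; rewrite diagE BformE addn0.
have bE : bmono b (i, k) = psmono k b`_i by [].
have kill0 x m : (m < k)%N -> psk x (psmono k b`_i) m = 0.
  move=> mk; rewrite psconv_monor; last exact: killing_biadditive.
  by rewrite ifN// -ltnNge.
have pre0 x m : (m <= k)%N -> precoef (psconv *%R xa (psk x (psmono k b`_i))) m = 0.
  case: m => //= m mk; rewrite {1}/psconv big1// => l _; rewrite kill0 ?mulr0//.
  have := ltn_ord l; lia.
by rewrite bE !pre0 ?subrr//; lia.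
Qed.

End QuasiRMatrix.

(** * The Lagrangian complement W(r) *)

Section SkewSeries.
Variables (F : fieldType) (g : lieAlgType F) (b : (\dim {:g}).-tuple g).
Hypothesis b_on : killing_orthonormal_basis b.
Variables (n : nat) (alpha : int -> F) (u : nat -> F).
Hypothesis u_inv : ps_inverse u (xn_alpha n alpha).
Local Notation B := (@Bform F g n alpha).
Local Notation br := (@loop_lie F g n).
Local Notation e p := (diag n (bmono b p)).
Local Notation coordT J := ('I_(\dim {:g}) * 'I_J)%type.
Local Notation basis_idx x := ((x.1, nat_of_ord x.2) : idx g).

Lemma quadratic_loop : quadratic_lie br B.
Proof.
split; [exact: loop_lie_linear|exact: loop_lieC|exact: loop_jacobi|
  exact: Bform_linear|exact: BformC|exact: Bform_inv].
Qed.
Let Q := quadratic_loop.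

Definition diag_coord (c : idx g -> F) : loop g n := diag n (ps_of_coord b c).

Lemma diag_linear k (a c : nat -> g) :
  diag n (k *: a + c) = k *: diag n a + diag n c.
Proof. by rewrite !diagE loop_of_linear. Qed.

Lemma diag_coord_linear k a c :
  diag_coord (fun p => k * a p + c p) = k *: diag_coord a + diag_coord c.
Proof.
rewrite /diag_coord -diag_linear; congr diag; apply/funext => m.
rewrite [RHS](_ : _ = k *: ps_of_coord b a m + ps_of_coord b c m)//.
rewrite /ps_of_coord scaler_sumr -big_split /=.
by apply: eq_bigr => i _; rewrite scalerDl scalerA.
Qed.

Lemma diag_coordK a : diag_coord (ps_coord b a) = diag n a.
Proof. by rewrite /diag_coord ps_coordK. Qed.

Lemma diag_coord_opp a : diag_coord (fun p => - a p) = - diag_coord a.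
Proof.
have D0 : diag_coord (fun _ => 0) = 0.
  have := diag_coord_linear (-1) (fun _ => 0) (fun _ => 0).
  rewrite scaleN1r addNr => <-.
  by congr diag_coord; apply/funext => p; rewrite mulr0 addr0.
rewrite -scaleN1r -[RHS]addr0 -D0 -diag_coord_linear; congr diag_coord.
by apply/funext => p; rewrite mulN1r addr0.
Qed.

Variable r : lseries g n.
Hypothesis r_quasi : quasi_r_matrix b u r.
Definition term (r : lseries g n) (p : idx g) : loop g n := r p.2 p.1.
Local Notation rr := (term r).
Local Notation proj := (@Dproj F (loop g n) B (idx g) diag_coord rr).

Lemma term_diag p a : B (rr p) (diag n a) = ps_coord b a p.
Proof.
have [t [h [rE _ _]]] := r_quasi; case: p => i k.
rewrite /term rE (formDl Q) Bform_diag addr0.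
exact: singular_diag.
Qed.

Lemma term_iso p q : B (rr p) (rr q) = 0.
Proof.
have [t [h [rE hE rE']]] := r_quasi.
have sD p' a : B (singular b n u p'.2 p'.1) (diag_coord a) = a p'.
  by rewrite /diag_coord singular_diag// ps_of_coordK//; case: p'.
(* The skew-symmetry of r, paired with the singular part at p. *)
have skew : t p q = - hOmega h p q - t q p.
  have := congr1 (fun f : lseries g n => B (singular b n u p.2 p.1) (f q.2 q.1))
    (etrans (esym rE) rE') => /=.
  rewrite !(formDr Q) !(formNr Q) -addrA => /addrI.
  rewrite -[lseries_of b n t _ _]/(diag_coord (fun p' => t p' (q.1, q.2))) sD.
  rewrite -[lseries_of b n _ q.2 q.1]/(diag_coord (fun p' => hOmega h p' (q.1, q.2))) sD.
  rewrite -[lseries_of b n _ q.2 q.1]/(diag_coord (fun p' => t (q.1, q.2) p')) sD.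
  by case: q.
rewrite /term rE (formDl Q) !(formDr Q).
rewrite -[lseries_of b n t q.2 q.1]/(diag_coord (fun p' => t p' (q.1, q.2))).
rewrite -[lseries_of b n t p.2 p.1]/(diag_coord (fun p' => t p' (p.1, p.2))).
rewrite Bform_diag sD (formC Q (diag_coord _)) sD.
rewrite (singular_form b_on u_inv hE).
by case: p q skew => i k [j l] /= ->; rewrite /hOmega /=; ring.
Qed.

Lemma Dproj_diag a : proj (diag n a) = diag n a.
Proof.
rewrite -[in RHS]diag_coordK /Dproj; congr diag_coord; apply/funext => p.
exact: term_diag.
Qed.

Lemma term_basis p q : B (rr p) (e q) = (p == q)%:R.
Proof. by rewrite term_diag ps_coord_mono. Qed.

(** The difference of v and the finite sum over the r_p is orthogonal to Delta,
    hence in Delta by [Delta_perp], and it has the same projection as v. *)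
Lemma term_expansion v : exists J0, forall J, (J0 <= J)%N ->
  v = proj v + \sum_(x : coordT J) B v (e (basis_idx x)) *: rr (basis_idx x).
Proof.
have [J0 vJ0] := Bform_mono_bounded b alpha v; exists J0 => J JJ0.
set S := \sum_x _; have [p|a vS] := @Delta_perp _ _ _ b_on _ _ _ u_inv (v - S).
  rewrite (formDl Q) (formNl Q) (formC Q S) (form_sumr Q).
  case: p => i k; have [kJ|Jk] := ltnP k J; last first.
    rewrite vJ0 ?(leq_trans JJ0)// big1 ?subrr// => x _.
    rewrite (formZr Q) (formC Q _ (rr _)) term_basis xpair_eqE.
    by rewrite [X in _ && X]ltn_eqF ?andbF ?mulr0//; apply: leq_trans Jk.
  rewrite (bigD1 (i, Ordinal kJ))//= (formZr Q) (formC Q _ (rr _)).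
  rewrite term_basis eqxx mulr1.
  rewrite big1 ?addr0 ?subrr// => -[j l] jl.
  rewrite (formZr Q) (formC Q _ (rr _)) term_basis /=.
  rewrite (_ : _ == _ = false) ?mulr0//; apply/negbTE; move: jl.
  by rewrite !xpair_eqE.
have -> : proj v = v - S.
  rewrite vS -[RHS]Dproj_diag -vS /Dproj; congr diag_coord; apply/funext => p.
  rewrite (formDr Q) (formNr Q) (form_sumr Q) big1 ?subr0// => x _.
  by rewrite (formZr Q) term_iso mulr0.
by rewrite subrK.
Qed.

Lemma term_frame : lagrangian_frame br B diag_coord rr.
Proof.
split.
- exact: diag_coord_opp.
- by move=> a c; exact: Bform_diag.
- by move=> p a; rewrite term_diag ps_of_coordK.
- exact: term_iso.
- by move=> a c; rewrite /diag_coord !diagE loop_lieE -diagE Dproj_diag.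
move=> v w.
have [J0 vE] := term_expansion v; have [J1 wE] := term_expansion w.
have {}vE := vE _ (leq_maxl J0 J1); have {}wE := wE _ (leq_maxr J0 J1).
set v' := \sum_x _ in vE; set w' := \sum_x _ in wE.
have v'w' : B v' w' = 0.
  rewrite (form_sumr Q) big1// => x _; rewrite (formZr Q) (formC Q v') (form_sumr Q).
  by rewrite big1 ?mulr0// => y _; rewrite (formZr Q) term_iso mulr0.
have pp : B (proj v) (proj w) = 0 by exact: Bform_diag.
have Bw x : B x w = B x (proj w) + B x w' by rewrite {1}wE (formDr Q).
rewrite !Bw pp add0r; congr (_ + _).
by rewrite {1}vE (formDl Q) v'w' addr0.
Qed.
Let fr := term_frame.

Lemma Dproj_eq0 v : (forall p, B (rr p) v = 0) -> proj v = 0.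
Proof.
move=> rv0; have -> : proj v = diag_coord (fun p => - (0 : F)).
  by rewrite /Dproj; congr diag_coord; apply/funext => p; rewrite rv0 oppr0.
have := diag_coord_linear (-1) (fun _ => 0) (fun _ => 0).
rewrite scaleN1r addNr => <-; congr diag_coord.
by apply/funext => p; rewrite mulr0 addr0 oppr0.
Qed.

(** Finite linear combinations of the r_p are the solutions of the linear equations
    B(r_p, v) = 0: the form in which W(r) is used from now on. *)
Lemma Wspace_term v : Wspace r v <-> forall p, B (rr p) v = 0.
Proof.
split=> [[m [c [x [xr ->]]]] p|rv0].
  rewrite (form_sumr Q) big1// => i _; have [k [j ->]] := xr i.
  by rewrite (formZr Q) (term_iso p (j, k)) mulr0.
have [J vE] := term_expansion v; rewrite (vE J (leqnn _)) Dproj_eq0// add0r.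
rewrite (reindex _ (onW_bij _ (@enum_val_bij (coordT J)))).
exists #|{: coordT J}|.
exists (fun i => let x : coordT J := enum_val i in B v (e (basis_idx x))).
exists (fun i => let x : coordT J := enum_val i in rr (basis_idx x)); split=> // i.
by exists (enum_val i).2, (enum_val i).1.
Qed.

(** The form is continuous on Delta: pairing with an infinite combination of the
    e_q is done term by term. *)
Lemma Bform_series (a : idx g -> F) w :
  \sum_(q \in [set: idx g]) a q * B (e q) w = B (diag_coord a) w.
Proof.
have [J0 wE] := term_expansion w; have [J1 w0] := Bform_mono_bounded b alpha w.
rewrite [in RHS](wE _ (leq_maxl J0 J1)) (formDr Q) Bform_diag add0r.
rewrite (@fsum_inj _ _ (coordT (maxn J0 J1)) (fun x => basis_idx x)); last 2 first.
- by move=> [i k] [j l] [-> kl]; congr (_, _); apply: val_inj.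
- move=> [i k] xN; rewrite (formC Q) w0 ?mulr0//= leqNgt; apply/negP => kJ.
  by apply: (xN (i, Ordinal (leq_trans kJ (leq_maxr J0 J1)))).
rewrite (form_sumr Q); apply: eq_bigr => x _.
rewrite (formZr Q) (formC Q (diag_coord a)) term_diag ps_of_coordK// mulrC.
by congr (_ * _); exact: (formC Q).
Qed.

End SkewSeries.

(** * The structure corresponding to W(r) *)

Section Correspondence.
Variables (F : fieldType) (g : lieAlgType F) (b : (\dim {:g}).-tuple g).
Hypothesis b_on : killing_orthonormal_basis b.
Variables (n : nat) (alpha : int -> F) (u : nat -> F).
Hypothesis u_inv : ps_inverse u (xn_alpha n alpha).
Local Notation B := (@Bform F g n alpha).
Local Notation br := (@loop_lie F g n).
Local Notation e p := (diag n (bmono b p)).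
Local Notation coordT J := ('I_(\dim {:g}) * 'I_J)%type.
Local Notation basis_idx x := ((x.1, nat_of_ord x.2) : idx g).
Local Notation D := (diag_coord b n).
Let Q := quadratic_loop g n alpha.

Variable r : lseries g n.
Hypothesis r_quasi : quasi_r_matrix b u r.
Local Notation rr := (term r).
Local Notation proj := (@Dproj F (loop g n) B (idx g) D rr).
Let fr := term_frame b_on u_inv r_quasi.
Let W_term := Wspace_term b_on u_inv r_quasi.

Lemma Wspace_sub_proj v : Wspace r (v - proj v).
Proof.
by apply/W_term => p; rewrite (formDr Q) (formNr Q) (fr_dual fr) subrr.
Qed.

Lemma Wspace_iso v w : Wspace r v -> Wspace r w -> B v w = 0.
Proof.
move=> /W_term rv /W_term rw; rewrite (fr_polar fr) !Dproj_eq0// (form0l Q).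
by rewrite (formC Q) (form0l Q) addr0.
Qed.

Lemma Wspace_lagrangian : lagrangian alpha (Wspace r).
Proof.
apply/seteqP; split=> [v vW w wW|v vperp]; first exact: Wspace_iso.
apply/W_term => p; rewrite (formC Q); apply: vperp; apply/W_term => q.
exact: (fr_isor fr).
Qed.

Lemma Wspace_complement : complement_Delta (Wspace r).
Proof.
split=> [|v].
  apply/seteqP; split=> [v [/W_term rv [a _ va]]|v ->].
    by rewrite /= -va -(Dproj_diag b_on u_inv r_quasi) va Dproj_eq0.
  split; first by apply/W_term => p; rewrite (formC Q) (form0l Q).
  by exists 0 => //; rewrite diagE loop_of0.
exists (v - proj v), (proj v); split; last by rewrite subrK.
  exact: Wspace_sub_proj.
by exists (ps_of_coord b (fun p => B (rr p) v)).
Qed.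

Lemma coord_br_clie a c p : coord_br br B D rr a c p = clie b a c p.
Proof.
by rewrite /coord_br /D !diagE loop_lieE -diagE (term_diag b_on u_inv r_quasi).
Qed.

Definition delta_of (a : nat -> g) : tens2 g := cobr br B D rr (ps_coord b a).
Definition phi_of : tens3 g := cophi br B rr.

Lemma Bform2_term p q t : Bform2 b alpha (rr p) (rr q) t = t p q.
Proof.
rewrite /Bform2 (@fsum_inj _ _ unit (fun _ => (p, q))); last 2 first.
- by move=> [] [].
- move=> [p' q'] pqN /=; rewrite !(term_basis b_on u_inv r_quasi).
  rewrite -natrM mulnb; case: andP => [[/eqP pp' /eqP qq']|_]; last by rewrite mulr0.
  by case: (pqN tt); rewrite pp' qq'.
rewrite (big_pred1 tt) => [|[]//] /=.
by rewrite !(term_basis b_on u_inv r_quasi) !eqxx !mulr1.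
Qed.

Lemma Bform3_term p q z t : Bform3 b alpha (rr p) (rr q) (rr z) t = t p q z.
Proof.
rewrite /Bform3 (@fsum_inj _ _ unit (fun _ => (p, q, z))); last 2 first.
- by move=> [] [].
- move=> [[p' q'] z'] pqN /=; rewrite !(term_basis b_on u_inv r_quasi).
  rewrite -!natrM !mulnb; case: andP => [[/andP[/eqP pp' /eqP qq'] /eqP zz']|_].
    by case: (pqN tt); rewrite pp' qq' zz'.
  by rewrite mulr0.
rewrite (big_pred1 tt) => [|[]//] /=.
by rewrite !(term_basis b_on u_inv r_quasi) !eqxx !mulr1.
Qed.

(** The equations of the correspondence for f = r_p, f' = r_q, f'' = r_z already
    determine all the coordinates, since the r_p are dual to the e_p. *)
Lemma corresponds_unique delta phi : corresponds b alpha (Wspace r) delta phi ->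
  (forall a p q, delta a p q = delta_of a p q) /\
  (forall p q z, phi p q z = phi_of p q z).
Proof.
have rW p : Wspace r (rr p) by apply/W_term => q; exact: (fr_isor fr).
have prDelta v : Delta (proj v) by exists (ps_of_coord b (fun p => B (rr p) v)).
have split_proj v : v = proj v + (v - proj v) by rewrite addrC subrK.
move=> corr.
have {}corr p q := corr (rr p) (rr q) _ _ (rW p) (rW q)
  (prDelta (br (rr p) (rr q))) (Wspace_sub_proj _) (split_proj _).
split=> [a p q|p q z].
  have [+ _] := corr p q; move=> /(_ a); rewrite Bform2_term => ->.
  rewrite (formDl Q) (formNl Q) /delta_of /cobr (diag_coordK b_on).
  by rewrite [X in _ - X]Bform_diag subr0.
have [_ /(_ _ (rW z))] := corr p q; rewrite Bform3_term (fr_dual fr) => phiE.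
by rewrite -[LHS]opprK phiE /phi_of /cophi (formC Q).
Qed.

Lemma Wspace_expansion v : Wspace r v -> exists J0, forall J, (J0 <= J)%N ->
  v = \sum_(x : coordT J) B v (e (basis_idx x)) *: rr (basis_idx x) /\
  forall p, (J <= p.2)%N -> B v (e p) = 0.
Proof.
move=> /W_term rv; have [J0 vE] := term_expansion b_on u_inv r_quasi v.
have [J1 v0] := Bform_mono_bounded b alpha v.
exists (maxn J0 J1) => J; rewrite geq_max => /andP[JJ0 JJ1]; split.
  by rewrite [LHS](vE J)// Dproj_eq0// add0r.
by move=> p Jp; apply: v0; exact: leq_trans Jp.
Qed.

(** Both equations are linear in f, f', f'' in W(r), which are finite combinations
    of the r_p. *)
Lemma corresponds_structure : corresponds b alpha (Wspace r) delta_of phi_of.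
Proof.
move=> f f' p1 p2 fW f'W [a1 _ p1E] p2W ff'E.
have [J fE] := Wspace_expansion fW; have [J' f'E] := Wspace_expansion f'W.
split=> [a|f'' f''W].
  set K := maxn J J'; have [{}fE f0] := fE K (leq_maxl J J').
  have [{}f'E f'0] := f'E K (leq_maxr J J').
  have -> : B p2 (diag n a) = B (br f f') (diag n a).
    by rewrite ff'E (formDl Q) -p1E Bform_diag add0r.
  rewrite [in RHS]fE [in RHS]f'E (form_br_sum Q) pair_bigA /Bform2.
  rewrite (@fsum_inj _ _ (coordT K * coordT K)%type
    (fun x => (basis_idx x.1, basis_idx x.2))).
  - by apply: eq_bigr => x _; rewrite /delta_of /cobr (diag_coordK b_on).
  - by move=> [[i k] [j l]] [[i' k'] [j' l']] [-> /val_inj -> -> /val_inj ->].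
  move=> [[i k] [j l]] pqN /=.
  have [kK|kK] := leqP K k; first by rewrite f0// mul0r mulr0.
  have [lK|lK] := leqP K l; first by rewrite f'0// !mulr0.
  by case: (pqN ((i, Ordinal kK), (j, Ordinal lK))).
have [J'' f''E] := Wspace_expansion f''W.
set K := maxn J (maxn J' J''); have [{}fE f0] := fE K (leq_maxl _ _).
have [|{}f'E f'0] := f'E K; first by rewrite !leq_max leqnn orbT.
have [|{}f''E f''0] := f''E K; first by rewrite !leq_max leqnn !orbT.
have -> : B f'' p1 = B (br f f') f''.
  by rewrite ff'E (formC Q) (formDl Q) (Wspace_iso p2W f''W) addr0.
rewrite [in RHS]f''E (form_sumr Q).
rewrite /Bform3 (@fsum_inj _ _ (coordT K * coordT K * coordT K)%type
  (fun x => (basis_idx x.1.1, basis_idx x.1.2, basis_idx x.2))).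
- rewrite -(pair_bigA _ (fun x z =>
    - phi_of (basis_idx x.1) (basis_idx x.2) (basis_idx z) *
    (B f (e (basis_idx x.1)) * B f' (e (basis_idx x.2)) * B f'' (e (basis_idx z))))) /=.
  rewrite exchange_big; apply: eq_bigr => z _.
  rewrite (formZr Q) [in RHS]fE [in RHS]f'E (form_br_sum Q) pair_bigA mulr_sumr.
  by apply: eq_bigr => x _; rewrite /phi_of /cophi opprK [RHS]mulrC [LHS]mulrA.
- by move=> [[[i k] [j l]] [h m]] [[[i' k'] [j' l']] [h' m']]
    [-> /val_inj -> -> /val_inj -> -> /val_inj ->].
move=> [[[i k] [j l]] [h m]] pqN /=.
have [kK|kK] := leqP K k; first by rewrite f0// !mul0r mulr0.
have [lK|lK] := leqP K l; first by rewrite f'0// mulr0 mul0r mulr0.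
have [mK|mK] := leqP K m; first by rewrite f''0// !mulr0.
by case: (pqN ((i, Ordinal kK), (j, Ordinal lK), (h, Ordinal mK))).
Qed.

Lemma Bform_local v : exists J, forall a a' : nat -> g,
  (forall k, (k < J)%N -> a' k = a k) -> B v (diag n a') = B v (diag n a).
Proof.
have [J vE] := term_expansion b_on u_inv r_quasi v; exists J => a a' aE.
rewrite (vE J (leqnn _)) !(formDl Q) !Bform_diag !add0r.
rewrite !(formC Q (\sum_x _)) !(form_sumr Q); apply: eq_bigr => x _.
rewrite !(formZr Q) ![B (diag _ _) _](formC Q) !(term_diag b_on u_inv r_quasi).
by rewrite /ps_coord /= aE.
Qed.

(** A coefficient of the cobracket depends on finitely many coefficients of its
    argument; there are finitely many coefficients of degree below N. *)
Lemma delta_of_continuous : adic_continuous delta_of.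
Proof.
move=> a N; have /choice[J JP] := Bform_local.
exists (\max_(x : coordT N * coordT N)
  J (br (rr (basis_idx x.1)) (rr (basis_idx x.2)))) => a' aE [i k] [j l] /= klN.
rewrite /delta_of /cobr !(diag_coordK b_on); apply: JP => m mJ; apply: aE.
have kN : (k < N)%N by lia.
have lN : (l < N)%N by lia.
exact: leq_trans mJ (leq_bigmax ((i, Ordinal kN), (j, Ordinal lN))).
Qed.

Lemma ps_coord_lie a c :
  ps_coord b (ps_lie a c) = coord_br br B D rr (ps_coord b a) (ps_coord b c).
Proof. by apply/funext => p; rewrite coord_br_clie /clie !(ps_coordK b_on). Qed.

Lemma delta_l2_of t p q z :
  delta_l2 b delta_of t p q z = cobr br B D rr (t ^~ z) p q.
Proof. by rewrite /delta_l2 /delta_of (ps_of_coordK b_on). Qed.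

Lemma structure_quasi_lie_bialgebra : [pchar F] =i pred0 ->
  quasi_lie_bialgebra b delta_of phi_of.
Proof.
move=> charF; have two0 : 2%:R != 0 :> F by rewrite (GRing.pcharf0P F).1.
split.
- move=> c a a' p q.
  rewrite /delta_of /cobr !(diag_coordK b_on) diag_linear.
  by rewrite (formDr Q) (formZr Q).
- exact: delta_of_continuous.
- by move=> a p q; rewrite /delta_of (cobr_skew _ _ Q).
- by move=> p q z; rewrite /phi_of; exact: (cophi_skew _ Q).
- move=> a c p q; rewrite {1}/delta_of ps_coord_lie (cobr_cocycle Q fr).
  by rewrite !coord_br_clie.
- move=> a p q z; rewrite alt3_skew12 => [|p' q' z']; last first.
    by rewrite !delta_l2_of (cobr_skew _ _ Q).
  rewrite mulKf// !delta_l2_of (cobr_cojacobi Q fr) !coord_br_clie.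
  by [].
- apply: alt4_eq0 => // p q z w.
  have dE p' q' z' w' : delta_l3 b delta_of phi_of p' q' z' w' =
      cobr br B D rr (fun t => cophi br B rr t z' w') p' q'.
    by rewrite /delta_l3 /delta_of (ps_of_coordK b_on).
  rewrite !dE !(cobr_cophi Q fr) -!opprD (form_br_jacobi Q).
  by rewrite oppr0.
Qed.

End Correspondence.

(** * Twisting *)

Section Twisting.
Variables (F : fieldType) (g : lieAlgType F) (b : (\dim {:g}).-tuple g).
Hypothesis b_on : killing_orthonormal_basis b.
Variables (n : nat) (alpha : int -> F) (u : nat -> F).
Hypothesis u_inv : ps_inverse u (xn_alpha n alpha).
Local Notation B := (@Bform F g n alpha).
Local Notation br := (@loop_lie F g n).
Local Notation D := (diag_coord b n).
Let Q := quadratic_loop g n alpha.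
Variable r : lseries g n.
Hypothesis r_quasi : quasi_r_matrix b u r.
Variable s : tens2 g.
Hypothesis s_skew : skew2 s.
Local Notation rr := (term r).
Let fr := term_frame b_on u_inv r_quasi.
Local Notation rs := (r - lseries_of b n s).

Lemma diag_coord_sub (a c : idx g -> F) : D (fun p => a p - c p) = D a - D c.
Proof.
rewrite -diag_coord_opp -[D a]scale1r -diag_coord_linear; congr diag_coord.
by apply/funext => p; rewrite mul1r.
Qed.

Lemma quasi_r_matrix_sub : quasi_r_matrix b u rs.
Proof.
have [t [h [rE hE rE']]] := r_quasi.
exists (fun p q => t p q - s p q), h; split=> //.
  rewrite rE -addrA; congr (_ + _); apply/funext => k; apply/funext => i.
  by symmetry; exact: diag_coord_sub.
rewrite rE' -!addrA; congr (_ + (_ + _)); apply/funext => k; apply/funext => i.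
rewrite [RHS](_ : _ = - D (fun p => t (i, k) p - s (i, k) p))//.
rewrite diag_coord_sub opprD; congr (_ - _).
by rewrite -diag_coord_opp; congr diag_coord; apply/funext => p; exact: s_skew.
Qed.

Lemma term_sub p : term rs p = rr p - D (s ^~ p).
Proof. by case: p. Qed.

(** The equations of W(r - s) read B(r_p, v) = B(s_p, v).  For w = P v - v this
    says that the vector added to - w in the definition of the twist is P v. *)
Lemma twist_Wspace : twist b alpha (Wspace r) s = Wspace rs.
Proof.
have D_row p : D (s p) = - D (s ^~ p).
  by rewrite -diag_coord_opp; congr diag_coord; apply/funext => q; rewrite -s_skew.
apply/seteqP; split=> [_ [w /(Wspace_term b_on u_inv r_quasi) rw ->]|v].
  apply/(Wspace_term b_on u_inv quasi_r_matrix_sub) => p.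
  rewrite term_sub (formDl Q) (formNl Q) !(formDr Q) !(formNr Q) rw.
  rewrite -/(D _) (fr_dual fr) (fr_isoD fr) (Bform_series b_on u_inv r_quasi) D_row.
  by rewrite (formNl Q); ring.
move=> /(Wspace_term b_on u_inv quasi_r_matrix_sub) rsv.
exists (Dproj B D rr v - v).
  apply/(Wspace_term b_on u_inv r_quasi) => p.
  by rewrite (formDr Q) (formNr Q) (fr_dual fr) subrr.
rewrite -[X in X - _]/(D _) [X in D X](_ : _ = fun p => B (rr p) v).
  by rewrite opprB addrC subrK.
apply/funext => p; rewrite (Bform_series b_on u_inv r_quasi) (formDr Q) (formNr Q).
rewrite (fr_isoD fr) add0r D_row (formNl Q) opprK.
have /eqP := rsv p; rewrite term_sub (formDl Q) (formNl Q) subr_eq0.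
by move/eqP.
Qed.

End Twisting.

(* The correction to phi is - CYB(s) + 1/2 Alt((delta @ 1) s): this is the sign
   forced by phi = - psi (equivalently phi = - CYB(r)) and W_s = W(r - s). *)
Theorem corollary4 (F : closedFieldType) (charF : [pchar F] =i pred0)
    (g : lieAlgType F) (simple_g : simple_lie g)
    (b : (\dim {:g}).-tuple g) (b_orthonormal : killing_orthonormal_basis b)
    (n : nat) (alpha : int -> F)
    (u : nat -> F) (u_inv : ps_inverse u (xn_alpha n alpha))
    (r : lseries g n) (r_quasi : quasi_r_matrix b u r)
    (delta : (nat -> g) -> tens2 g) (phi : tens3 g)
    (qlb : quasi_lie_bialgebra b delta phi)
    (corr : corresponds b alpha (Wspace r) delta phi)
    (s : tens2 g) (s_skew : skew2 s) :
  let Ws := twist b alpha (Wspace r) s in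
  [/\ lagrangian alpha Ws /\ complement_Delta Ws,
      Ws = Wspace (r - lseries_of b n s),
      exists (delta_s : (nat -> g) -> tens2 g) (phi_s : tens3 g),
        corresponds b alpha Ws delta_s phi_s
    & forall (delta_s : (nat -> g) -> tens2 g) (phi_s : tens3 g),
        corresponds b alpha Ws delta_s phi_s ->
        [/\ quasi_lie_bialgebra b delta_s phi_s,
            forall a p q, delta_s a p q = delta a p q + act2 b a s p q
          & forall p q z, phi_s p q z =
              phi p q z - CYB b s p q z
              + 2%:R^-1 * alt3 (delta_l2 b delta s) p q z]].
Proof.
have two0 : 2%:R != 0 :> F by rewrite (GRing.pcharf0P F).1.
have rs_quasi := quasi_r_matrix_sub r_quasi s_skew.
rewrite /= (twist_Wspace b_orthonormal u_inv r_quasi s_skew).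
have [deltaE phiE] := corresponds_unique b_orthonormal u_inv r_quasi corr.
have Q := quadratic_loop g n alpha.
have fr := term_frame b_orthonormal u_inv r_quasi.
have coord_br_clie := coord_br_clie b_orthonormal u_inv r_quasi.
split=> //.
- split; first exact: (Wspace_lagrangian b_orthonormal u_inv rs_quasi).
  exact: (Wspace_complement b_orthonormal u_inv rs_quasi).
- exists (delta_of b alpha (r - lseries_of b n s)).
  exists (phi_of alpha (r - lseries_of b n s)).
  exact: (corresponds_structure b_orthonormal u_inv rs_quasi).
move=> delta_s phi_s corr_s.
have [delta_sE phi_sE] := corresponds_unique b_orthonormal u_inv rs_quasi corr_s.
have -> : delta_s = delta_of b alpha (r - lseries_of b n s).
  by apply/funext => a; apply/funext => p; apply/funext => q; exact: delta_sE.
have -> : phi_s = phi_of alpha (r - lseries_of b n s).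
  by apply/funext => p; apply/funext => q; apply/funext => z; exact: phi_sE.
have -> : delta = delta_of b alpha r.
  by apply/funext => a; apply/funext => p; apply/funext => q; exact: deltaE.
split.
- exact: (structure_quasi_lie_bialgebra b_orthonormal u_inv rs_quasi charF).
- move=> a p q; rewrite /delta_of {1}/cobr !term_sub (cobr_twist Q fr s_skew).
  by rewrite !coord_br_clie.
move=> p q z; rewrite phiE /phi_of {1}/cophi !term_sub (cophi_twist Q fr s_skew).
rewrite !coord_br_clie /CYB; congr (_ + _).
rewrite alt3_skew12 => [|p' q' z']; last first.
  by rewrite !(delta_l2_of b_orthonormal) (cobr_skew _ _ Q).
by rewrite mulKf// !(delta_l2_of b_orthonormal).
Qed.
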